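(* Let $\mathcal F$ be the class of non-constant Riemann integrable functions $f\colon[0,1]\to(0,\infty)$ with $M_-=\inf_{[0,1]}f>0$ and $M_+=\sup_{[0,1]}f<\infty$. For $f\in\mathcal F$ and $x>0$ put $\beta_x=\int_{[0,1]}f^x(y)\,dy$. For $\lambda\in(0,\infty)$ let $\Delta_\phi$ be the friendship bias of the root of the multi-type Galton-Watson tree that is the local limit of the inhomogeneous Erdős-Rényi random graph with edge probabilities $\frac\lambda nf(\frac in)f(\frac jn)\wedge1$ (described in the context). Then for every $f\in\mathcal F$ and $\lambda\in(0,\infty)$, $$\mathbb P\{\Delta_\phi\ge x\}\sim\mathbb P\{d_\phi=1\}\,\mathbb P\{d_1\ge x\},\qquad x\to\infty.$$ In particular, $$\mathbb P\{\Delta_\phi\ge x\}\asymp\frac1{\sqrt x}\,\beta_x\,e^{-x\log(\frac{x}{\lambda\beta_1e})},\qquad x\to\infty.$$ The asymptotic behaviour of $\beta_x$ can be derived in the following two cases: (a) If $\ell_1(\{y\in[0,1]: f(y)=M_+\})>0$, where $\ell_1$ is Lebesgue measure on $[0,1]$, then $\beta_x\asymp M_+^x$ as $x\to\infty$. (b) If for some $y_\star\in[0,1]$ and $\alpha\in(0,\infty)$ one has $f(y_\star)=M_+$ and $f(y_\star)-f(y)\asymp|y-y_\star|^\alpha$ as $y\to y_\star$, and $f$ is bounded away from $M_+$ outside any neighbourhood of $y_\star$, then $\beta_x\asymp x^{-1/\alpha}M_+^x$ as $x\to\infty$.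
   Context: The limiting rooted tree: the root $\phi$ has type $Q$ uniform on $[0,1]$; every vertex other than the root independently has a type with density $\beta_1^{-1}f(y)$, $y\in[0,1]$; given the types, a vertex of type $x$ independently has a Poisson($\lambda\beta_1f(x)$) number of children. Thus, with $d_\phi$ the number of children of the root and $d_j$ the number of children of the $j$-th child of the root, $d_\phi$ is mixed Poisson($\lambda\beta_1f(Q)$), and $d_1,d_2,\ldots$ are i.i.d., independent of $d_\phi$, each mixed Poisson($\lambda\beta_1f(Q'_j)$) with $Q'_j$ i.i.d. of density $\beta_1^{-1}f$. The friendship bias of the root is $$\Delta_\phi=\Big[\frac1{d_\phi}\sum_{j=1}^{d_\phi}(d_j+1)-d_\phi\Big]\mathbb 1_{\{d_\phi\ne0\}}$$ (so $\Delta_\phi=0$ when $d_\phi=0$). Notation: $a_x\sim b_x$ means $a_x/b_x\to1$; $a_x\asymp b_x$ means $0<\liminf a_x/b_x\le\limsup a_x/b_x<\infty$ (in the indicated limit).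
   Formalization: The second display (order of P{Δ_φ ≥ x}) is proved for integer x → ∞ only; for real x it is false, since P{d_1 ≥ x} is constant on (k,k+1] while the right-hand side drops there by a factor of order k. *)

(* Defs.v *)
From HB Require Import structures.
From mathcomp Require Import all_boot all_order all_algebra.
From mathcomp Require Import all_classical all_reals all_analysis.

Set Implicit Arguments.
Unset Strict Implicit.
Unset Printing Implicit Defensive.

Import Order.TTheory GRing.Theory Num.Theory.
Import numFieldNormedType.Exports.

Local Open Scope classical_set_scope.
Local Open Scope ring_scope.

Section asymptotics.
Context {R : realType} {T : topologicalType}.

Definition asymp_equiv (F : set_system T) (a b : T -> R) : Prop :=
  a x / b x @[x --> F] --> (1 : R).

Definition asymp_order (F : set_system T) (a b : T -> R) : Prop :=
  let r := fun x : T => (a x / b x)%:E in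
  [/\ (0 < limf_einf r F)%E,
      (limf_einf r F <= limf_esup r F)%E &
      (limf_esup r F < +oo)%E].

End asymptotics.

Section riemann_integrability.
Context {R : realType}.

(* The partition points are a :: s and xi i is the tag of the i-th cell. *)
Definition riemann_sum (a b : R) (f : R -> R) (s : seq R) (xi : nat -> R) : R :=
  let t := nth b (a :: s) in
  \sum_(0 <= i < size s) f (xi i) * (t i.+1 - t i).

Definition riemann_integrable (a b : R) (f : R -> R) : Prop :=
  exists I : R, forall e : R, 0 < e -> exists2 d : R, 0 < d &
    forall (s : seq R) (xi : nat -> R),
      itv_partition a b s ->
      (forall i : nat, (i < size s)%N ->
         let t := nth b (a :: s) in
         t i <= xi i <= t i.+1 /\ t i.+1 - t i < d) ->
      `|riemann_sum a b f s xi - I| < e.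

End riemann_integrability.

Section profile.
Context {R : realType}.

(* Functions [0,1] -> (0,oo) are represented by total functions on R; only
   their values on [0,1] are ever used. *)
Implicit Type f : R -> R.

Definition M_minus f : R := inf (f @` `[0, 1]).
Definition M_plus f : R := sup (f @` `[0, 1]).

Record class_F f : Prop := {
  class_F_gt0 : forall y : R, y \in `[0, 1] -> 0 < f y ;
  class_F_nonconstant : ~ exists c : R, forall y : R, y \in `[0, 1] -> f y = c ;
  class_F_riemann : riemann_integrable 0 1 f ;
  class_F_inf : 0 < M_minus f ;
  (* M_plus f is finite *)
  class_F_sup : has_ubound (f @` `[0, 1]) }.

(* The completed measure is needed because a Riemann integrable function is
   Lebesgue measurable but need not be Borel measurable. *)
Definition beta f (x : R) : R :=
  \int[@completed_lebesgue_measure R]_(y in `[0, 1]) (f y `^ x).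

End profile.

Section tree.
Context {R : realType} {d : measure_display} {Omega : measurableType d}.

(* Vertices are Ulam-Harris labels: [::] is the root and rcons v j is the
   child number j (counted from 0) of v.  Each label v carries a type Q v and
   an offspring number N v; the tree consists of the labels v such that j < N u
   for every prefix rcons u j of v.  Labels outside the tree carry marks too,
   so that the offspring numbers of the children of the root form an infinite
   i.i.d. sequence independent of the degree of the root. *)

Definition type_density (f : R -> R) (v : seq nat) (y : R) : R :=
  if v == [::] then 1 else f y / beta f 1.

Record is_limit_tree (f : R -> R) (lambda : R) (P : probability Omega R)
    (Q : seq nat -> {RV P >-> R}) (N : seq nat -> {RV P >-> nat}) : Prop := {
  limit_tree_type : forall (v : seq nat) (A : set R), measurable A ->
    P (Q v @^-1` A) =
    (\int[@completed_lebesgue_measure R]_(y in `[0%R, 1%R] `&` A)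
       (type_density f v y)%:E)%E ;
  (* conditionally on Q v = y, N v is Poisson with mean lambda * beta_1 * f y *)
  limit_tree_offspring : forall (v : seq nat) (A : set R) (k : nat),
    measurable A ->
    P (Q v @^-1` A `&` N v @^-1` [set k]) =
    (\int[@completed_lebesgue_measure R]_(y in `[0%R, 1%R] `&` A)
       (type_density f v y * poisson_pmf (lambda * beta f 1 * f y) k)%:E)%E ;
  (* the marks (Q v, N v) of distinct vertices are mutually independent *)
  limit_tree_independent :
    forall (S : seq (seq nat)) (A : seq nat -> set R) (k : seq nat -> nat),
    uniq S -> (forall v, measurable (A v)) ->
    P (\bigcap_(v in [set` S]) (Q v @^-1` A v `&` N v @^-1` [set k v])) =
    (\prod_(v <- S) P (Q v @^-1` A v `&` N v @^-1` [set k v]))%E }.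

Definition deg_root (N : seq nat -> Omega -> nat) (w : Omega) : nat :=
  N [::] w.

(* number of children of the child number j of the root, counted from 0 *)
Definition deg_child (N : seq nat -> Omega -> nat) (j : nat) (w : Omega) : nat :=
  N [:: j] w.

Definition friendship_bias (N : seq nat -> Omega -> nat) (w : Omega) : R :=
  let D := deg_root N w in
  if D == 0%N then 0
  else (\sum_(j < D) ((deg_child N j w)%:R + 1)) / D%:R - D%:R.

Definition Pr (P : probability Omega R) (A : set Omega) : R := fine (P A).

End tree.

(* Main.v *)
Require Import Defs.
From HB Require Import structures.
From mathcomp Require Import all_boot all_order all_algebra.
From mathcomp Require Import all_classical all_reals all_analysis.
From mathcomp Require Import measurable_realfun.
From mathcomp Require Import ring lra.
Import Order.TTheory GRing.Theory Num.Theory.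
Import numFieldNormedType.Exports.
Local Open Scope classical_set_scope.
Local Open Scope ring_scope.

(* A root of degree one has bias equal to the degree of its only child.  If the
   root has m >= 2 children and bias at least x, then one of the children has
   degree at least x + m - 1 >= x + 1, which by the union bound contributes at
   most E[d_phi] P(d_1 >= x + 1).  A child offspring law p satisfies
   p_(k+1) <= (Lam / (k + 1)) p_k with Lam = lambda beta_1 M_+, so
   P(d_1 >= x + 1) = O(P(d_1 >= x) / x) and P(d_1 >= n) is of the order of
   p_n, that is, of (lambda beta_1)^n beta_n / n!; Stirling's bounds conclude.
   The same ratio estimate for the root gives E[d_phi] <= Lam.

   All integrals are against the completed Lebesgue measure, hence the need for
   the measurability of a Riemann integrable f: Darboux sums bracket f between
   step functions whose gaps have arbitrarily small integral.

   For a maximum of order alpha at ystar, put h = x^(-1/alpha).  An interval of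
   length h near ystar gives the lower bound on beta_x.  For the upper bound,
   (f / M_+)^x <= exp(- k (|y - ystar| / h)^alpha) <= K / (1 + ((y-ystar)/h)^2),
   whose integral is at most K pi h. *)

(** * Order of magnitude expressed by two-sided bounds *)

Section asymptotic_order.
Context {R : realType} {T : topologicalType}.

Lemma asymp_order_bounds (F : set_system T) (a b : T -> R) : Filter F ->
  asymp_order F a b ->
  exists2 c, 0 < c & exists2 C, 0 < C &
    \forall x \near F, c <= a x / b x <= C.
Proof.
move=> FF [inf0 _ sup1].
move: inf0; rewrite limf_einfE => /ereal_sup_gt[_ [V FV <-]] infV.
move: sup1; rewrite limf_esupE => /ereal_inf_lt[_ [W FW <-]] supW.
have [c c0 cV] : exists2 c : R, 0 < c & forall x, V x -> c <= a x / b x.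
  set i := ereal_inf _ in infV.
  have iV x : V x -> (i <= (a x / b x)%:E)%E.
    by move=> Vx; apply: ereal_inf_lbound; exists x.
  (* An infimum equal to [+oo] forces [V] to be empty, and then any positive constant serves. *)
  move: infV iV; case: i => [r||] // i0 iV.
    by exists r => // x /iV.
  by exists 1 => // x /iV.
have [C CW] : exists C : R, forall x, W x -> a x / b x <= C.
  set s := ereal_sup _ in supW.
  have sW x : W x -> ((a x / b x)%:E <= s)%E.
    by move=> Wx; apply: ereal_sup_ubound; exists x.
  move: supW sW; case: s => [r||] // _ sW.
    by exists r => x /sW.
  by exists 0 => x /sW.
exists c => //; exists (Num.max C 1); first by rewrite lt_max ltr01 orbT.
apply: filterS2 FV FW => x /cV -> /CW /= h.
by rewrite le_max h.
Qed.

Lemma bounds_asymp_order (F : set_system T) (a b : T -> R) (c C : R) :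
  ProperFilter F -> 0 < c ->
  (\forall x \near F, 0 < b x /\ c * b x <= a x <= C * b x) ->
  asymp_order F a b.
Proof.
move=> FF c0 /= h.
have {}h : F [set x | c <= a x / b x <= C].
  by apply: filterS h => x /= [b0]; rewrite ler_pdivlMr// ler_pdivrMr.
have [x0 /andP[ca aC]] := filter_ex h.
have infc : (c%:E <= limf_einf (fun x => (a x / b x)%:E) F)%E.
  rewrite limf_einfE; apply: ereal_sup_ge.
  exists (ereal_inf [set (a x / b x)%:E | x in [set x | c <= a x / b x <= C]]).
    by exists [set x | c <= a x / b x <= C].
  by apply: le_ereal_inf_tmp => _ [y /= /andP[+ _] <-]; rewrite lee_fin.
have supC : (limf_esup (fun x => (a x / b x)%:E) F <= C%:E)%E.
  rewrite limf_esupE; apply: ereal_inf_le.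
  exists (ereal_sup [set (a x / b x)%:E | x in [set x | c <= a x / b x <= C]]).
    by exists [set x | c <= a x / b x <= C].
  by apply: ge_ereal_sup => _ [y /= /andP[_ +] <-]; rewrite lee_fin.
split.
- by rewrite (lt_le_trans _ infc)// lte_fin.
(* Any two members of a proper filter meet, and the ratio at a common point separates the infimum
   over one from the supremum over the other. *)
- rewrite limf_einfE limf_esupE.
  apply: ge_ereal_sup => _ [V FV <-]; apply: le_ereal_inf_tmp => _ [W FW <-].
  have [y [Vy Wy]] := filter_ex (filterI FV FW).
  apply: (@le_trans _ _ (a y / b y)%:E).
    by apply: ereal_inf_lbound; exists y.
  by apply: ereal_sup_ubound; exists y.
- by rewrite (le_lt_trans supC)// ltry.
Qed.

End asymptotic_order.

(** * Riemann integrable functions are Lebesgue measurable *)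

Section riemann_measurable.
Context {R : realType}.
Implicit Types (f : R -> R) (N : nat).

Let node N i : R := i%:R / N%:R.
(** The cells are half-open so that they tile [[0, 1[] without overlap; the point 1 is restored only
    when measurability of [f] is proved. *)
Let cell N i : set R := `[node N i, node N i.+1[%classic.

Let nodeB N i : node N i.+1 - node N i = N%:R^-1.
Proof. by rewrite /node -mulrBl -natrB// subSnn mul1r. Qed.

Let node_le N i : node N i <= node N i.+1.
Proof. by rewrite -subr_ge0 nodeB invr_ge0. Qed.

Let itv_node N i y : (i < N)%N -> node N i <= y <= node N i.+1 ->
  y \in `[0, 1].
Proof.
move=> iN /andP[iy yi]; have N0 : 0 < N%:R :> R.
  by rewrite ltr0n (leq_ltn_trans _ iN).
rewrite in_itv/= (le_trans _ iy) ?divr_ge0//= (le_trans yi)//.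
by rewrite ler_pdivrMr// mul1r ler_nat.
Qed.

Let uniform_partition N : (0 < N)%N ->
  itv_partition 0 1 (mkseq (fun i => node N i.+1) N).
Proof.
move=> N0; have N0R : 0 < N%:R :> R by rewrite ltr0n.
split.
  apply/(pathP 0) => i; rewrite size_mkseq => iN.
  rewrite (nth_mkseq _ _ iN).
  have -> : nth 0 (0 :: mkseq (fun i => node N i.+1) N) i = node N i.
    case: i iN => [|i] iN /=; first by rewrite /node mul0r.
    by rewrite nth_mkseq// ltnW.
  by rewrite -subr_gt0 nodeB invr_gt0.
rewrite (last_nth 0) size_mkseq.
case: N N0 N0R => // N _ N0R /=.
by rewrite nth_mkseq// /node divff// gt_eqF.
Qed.

(** On each cell of a fine uniform partition, tags are chosen within e/4 of the supremum and of the
    infimum of [f]. Both Riemann sums lie within e/4 of the integral, so the Darboux gap is below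
    e/4 + e/4 + e/2. *)
Lemma riemann_darboux f : riemann_integrable 0 1 f ->
  has_ubound (f @` `[0, 1]) -> has_lbound (f @` `[0, 1]) ->
  forall e, 0 < e -> exists N, exists lo up : nat -> R,
  [/\ (0 < N)%N,
      forall i y, (i < N)%N -> node N i <= y <= node N i.+1 ->
        lo i <= f y <= up i,
      (forall i, lo i <= up i) &
      \sum_(0 <= i < N) (up i - lo i) / N%:R < e].
Proof.
move=> [I fI] ubf lbf e e0.
have e40 : 0 < e / 4 by rewrite divr_gt0.
have [d d0 {fI}fI] := fI _ e40.
have [N N0 Nd] : exists2 N, (0 < N)%N & N%:R^-1 < d.
  exists (Num.truncn d^-1).+1 => //.
  by rewrite invf_plt ?posrE// truncnS_gt.
have N0R : 0 < N%:R :> R by rewrite ltr0n.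
pose Jc i : set R := [set y | node N i <= y <= node N i.+1].
have JcE i : Jc i (node N i) by rewrite /Jc/= lexx node_le.
have Jc01 i : (i < N)%N -> Jc i `<=` `[0, 1].
  by move=> iN y; exact: itv_node.
have ubJ i : (i < N)%N -> has_ubound (f @` Jc i).
  move=> iN; have [M Mf] := ubf; exists M => _ [y Jy <-]; apply: Mf.
  by exists y => //; exact: Jc01 Jy.
have lbJ i : (i < N)%N -> has_lbound (f @` Jc i).
  move=> iN; have [M Mf] := lbf; exists M => _ [y Jy <-]; apply: Mf.
  by exists y => //; exact: Jc01 Jy.
have neJ i : f @` Jc i !=set0 by exists (f (node N i)); exists (node N i).
have /choice[xi xiP] : forall i, exists y, Jc i y /\
    ((i < N)%N -> sup (f @` Jc i) - e / 4 < f y).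
  move=> i; have [iN|Ni] := boolP (i < N)%N; last first.
    by exists (node N i); split.
  have /sup_adherent := conj (neJ i) (ubJ i iN).
  by move=> /(_ _ e40)[_ [y Jy <-] ?]; exists y.
have /choice[et etP] : forall i, exists y, Jc i y /\
    ((i < N)%N -> f y < inf (f @` Jc i) + e / 4).
  move=> i; have [iN|Ni] := boolP (i < N)%N; last first.
    by exists (node N i); split.
  have /inf_adherent := conj (neJ i) (lbJ i iN).
  by move=> /(_ _ e40)[_ [y Jy <-] ?]; exists y.
pose s := mkseq (fun i => node N i.+1) N.
have sP := uniform_partition _ N0.
have tE i : (i <= N)%N -> nth 1 (0 :: s) i = node N i.
  case: i => [|i] iN /=; first by rewrite /node mul0r.
  by rewrite nth_mkseq.
have RS z : (forall i, Jc i (z i)) ->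
    `|\sum_(0 <= i < N) f (z i) / N%:R - I| < e / 4.
  move=> zP; have := fI s z sP; rewrite /riemann_sum size_mkseq.
  rewrite (@eq_big_nat _ _ _ _ _ _ (fun i => f (z i) / N%:R)); last first.
    by move=> i /andP[_ iN]; rewrite !tE ?(ltnW iN)// nodeB.
  move=> RSz; apply: RSz => i iN /=.
  rewrite -[nth _ s i]/(nth 1 (0 :: s) i.+1) !tE ?(ltnW iN)// nodeB.
  by split => //; exact: zP.
have xS := RS xi (fun i => (xiP i).1).
have eS := RS et (fun i => (etP i).1).
(* Past the last cell both bounds default to 0, which keeps [lo i <= up i] for every index. *)
exists N, (fun i => if (i < N)%N then inf (f @` Jc i) else 0),
  (fun i => if (i < N)%N then sup (f @` Jc i) else 0); split => //.
- move=> i y iN Jy; rewrite iN; apply/andP; split.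
    by apply: ge_inf; [exact: lbJ|exists y].
  by apply: ub_le_sup; [exact: ubJ|exists y].
- move=> i; case: ifPn => // iN.
  apply: (@le_trans _ _ (f (node N i))).
    by apply: ge_inf; [exact: lbJ|exists (node N i)].
  by apply: ub_le_sup; [exact: ubJ|exists (node N i)].
- apply: (@le_lt_trans _ _ (\sum_(0 <= i < N)
      (f (xi i) / N%:R - f (et i) / N%:R + (e / 4 + e / 4) / N%:R))).
    rewrite !big_nat; apply: ler_sum => i /= iN.
    rewrite iN -mulrBl -mulrDl ler_pM2r ?invr_gt0//.
    have [_ /(_ iN) h1] := xiP i; have [_ /(_ iN) h2] := etP i.
    by rewrite -!/(Jc _) ; lra.
  rewrite big_split/= sumrB sumr_const_nat subn0.
  rewrite -[X in _ + X]mulr_natr divfK ?gt_eqF//.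
  move: xS eS; rewrite !ltr_norml => /andP[? ?] /andP[? ?].
  by lra.
Qed.

Let cell_disj N i j y : cell N i y -> cell N j y -> i = j.
Proof.
(* For [N = 0] all nodes are 0 by the convention on the inverse of 0, so every cell is empty. *)
have [->|N0] := posnP N.
  rewrite /cell/node/= invr0 !mulr0 in_itv/= => /andP[/le_lt_trans/[apply]].
  by rewrite ltxx.
have N0R : 0 < N%:R :> R by rewrite ltr0n.
rewrite /cell/node/= !in_itv/= !ler_pdivrMr// !ltr_pdivlMr//.
move=> /andP[h1 h2] /andP[h3 h4]; apply/eqP.
rewrite eqn_leq -ltnS -[X in _ && X]ltnS -!(ltr_nat R).
by rewrite (le_lt_trans h1)// (le_lt_trans h3).
Qed.

Let cell_ex N y : (0 < N)%N -> y \in `[0, 1[ ->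
  exists2 i, (i < N)%N & cell N i y.
Proof.
move=> N0; have N0R : 0 < N%:R :> R by rewrite ltr0n.
rewrite in_itv/= => /andP[y0 y1].
have /truncn_itv/andP[h1 h2] : 0 <= y * N%:R by rewrite mulr_ge0// ltW.
exists (Num.truncn (y * N%:R)).
  rewrite -(ltr_nat R) (le_lt_trans h1)//.
  by rewrite gtr_pMl.
by rewrite /cell/node/= in_itv/= ler_pdivrMr// ltr_pdivlMr// h1.
Qed.

Let measurable_cell N i : measurable (cell N i).
Proof. exact: measurable_itv. Qed.

Let step N (c : nat -> R) (y : R) := \sum_(0 <= i < N) c i * \1_(cell N i) y.

Let measurable_step N c : measurable_fun setT (step N c).
Proof.
by apply: measurable_sum => i; exact: measurable_funM.
Qed.

Let stepE N c i y : (i < N)%N -> cell N i y -> step N c y = c i.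
Proof.
move=> iN iy; rewrite /step big_mkord.
rewrite (big_only1 (Ordinal iN))//= => [|j ji _].
  by rewrite indicE mem_set// mulr1.
rewrite indicE memNset ?mulr0// => jy.
by move: ji; rewrite -val_eqE/= (cell_disj _ _ _ _ jy iy) eqxx.
Qed.

Let integral_step N c : (0 < N)%N -> (forall i, 0 <= c i) ->
  (\int[lebesgue_measure]_y (step N c y)%:E =
   (\sum_(0 <= i < N) c i / N%:R)%:E)%E.
Proof.
move=> N0 c0; rewrite /step.
under eq_integral do rewrite -sumEFin.
rewrite ge0_integral_sum//=; last 2 first.
- move=> i; apply/measurable_EFinP; apply: measurable_funM => //.
  by apply: measurable_indic; exact: measurable_cell.
- by move=> i y _; rewrite lee_fin mulr_ge0.
rewrite -sumEFin; apply: eq_bigr => i _.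
under eq_integral do rewrite EFinM.
have mi := measurable_cell N i.
rewrite ge0_integralZl_EFin//; last first.
  by apply/measurable_EFinP/measurable_indic.
rewrite integral_indic// setIT.
transitivity ((c i)%:E *
    lebesgue_measure (`[node N i, node N i.+1[%classic : set R))%E => //.
rewrite lebesgue_measure_itv/= lte_fin.
by rewrite -subr_gt0 nodeB invr_gt0 ltr0n N0 -EFinB nodeB.
Qed.

(** The Darboux bounds, spread over the cells, give step functions that are Borel although [f] may
    not be. *)
Lemma riemann_integrable_borel_bracket f : riemann_integrable 0 1 f ->
  has_ubound (f @` `[0, 1]) -> has_lbound (f @` `[0, 1]) ->
  forall e, 0 < e -> exists lo gap : R -> R,
  [/\ measurable_fun setT lo, measurable_fun setT gap,
      forall y, 0 <= gap y,
      forall y, y \in `[0, 1[ -> lo y <= f y <= lo y + gap y &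
      (\int[lebesgue_measure]_y (gap y)%:E < e%:E)%E].
Proof.
move=> If ubf lbf e e0.
have [N [lo [up [N0 fN loup Se]]]] := riemann_darboux f If ubf lbf e e0.
exists (step N lo), (step N (fun i => up i - lo i)); split => //.
- move=> y; apply: sumr_ge0 => i _; rewrite mulr_ge0//.
  by rewrite subr_ge0.
- move=> y /(cell_ex _ _ N0)[i iN iy]; rewrite !(stepE _ _ i)//.
  rewrite subrKC; apply: fN => //.
  by move: iy; rewrite /cell/= in_itv/= => /andP[-> /ltW].
- by rewrite integral_step// ?lte_fin// => i; rewrite subr_ge0.
Qed.

End riemann_measurable.

(** * Transfer between the Borel and the completed Lebesgue measure *)

Lemma ge0_integral_image_measure d1 d2 (X : measurableType d1)
    (Y : measurableType d2) (R : realType) (phi : X -> Y)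
    (mphi : measurable_fun setT phi) (mu : {measure set X -> \bar R})
    (nu : {measure set Y -> \bar R}) :
  (forall A, measurable A -> nu A = mu (phi @^-1` A)) ->
  forall (D : set Y) (g : Y -> \bar R), measurable D -> measurable_fun D g ->
  {in D, forall y, (0 <= g y)%E} ->
  (\int[nu]_(y in D) g y = \int[mu]_(x in phi @^-1` D) (g \o phi) x)%E.
Proof.
move=> nuE D g mD mg g0; rewrite -(ge0_integral_pushforward mphi)//.
by apply: eq_measure_integral => //= A mA _; rewrite nuE.
Qed.

Section completed_lebesgue.
Context {R : realType}.
Local Notation mu := (@lebesgue_measure R).
Local Notation cmu := (@completed_lebesgue_measure R).
Local Notation C := (caratheodory_type (wlength (@idfun R))^*%mu).

Lemma measurable_completed (A : set R) : measurable A -> measurable (A : set C).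
Proof. exact: sub_caratheodory. Qed.

Lemma measurable_completed_id :
  measurable_fun [set: C] (idfun : C -> measurableTypeR R).
Proof. by move=> _ A mA; rewrite setTI; exact: measurable_completed. Qed.

Lemma measurable_fun_completed (D : set C) (f : R -> R) :
  measurable_fun setT f -> measurable_fun D (f : C -> R).
Proof.
move=> mf; apply: (@measurable_funTS _ _ C).
exact: (measurableT_comp mf measurable_completed_id).
Qed.

Lemma completed_lebesgue_measureE (A : set R) : cmu A = mu A.
Proof. by []. Qed.

(** The identity from the completed to the Borel sigma-algebra is measurable and carries [cmu] to
    [mu], so a change of variables applies. Integrals of Borel functions can then be computed by
    calculus. *)
Lemma ge0_integral_completed (D : set R) (f : R -> R) :
  measurable D -> measurable_fun setT f -> (forall y, D y -> 0 <= f y) ->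
  (\int[cmu]_(y in D) (f y)%:E = \int[mu]_(y in D) (f y)%:E)%E.
Proof.
move=> mD mf f0.
have mfD : measurable_fun (D : set (measurableTypeR R)) (EFin \o f).
  by apply/measurable_EFinP; apply: measurable_funTS; exact: mf.
have fD0 : {in D, forall y, (0 <= (EFin \o f) y)%E}.
  by move=> y /set_mem Dy; rewrite lee_fin f0.
have muE A : measurable A ->
    mu A = cmu ((idfun : C -> measurableTypeR R) @^-1` A).
  by move=> _; exact/esym/completed_lebesgue_measureE.
exact: esym (ge0_integral_image_measure _ _ _ _ _ _ measurable_completed_id
  cmu mu muE _ _ mD mfD fD0).
Qed.

(* The infimum of the gaps of the brackets has integral 0, so f coincides
   almost everywhere with the supremum of the lower brackets. *)
Lemma riemann_integrable_measurable (f : R -> R) :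
  riemann_integrable 0 1 f ->
  has_ubound (f @` `[0, 1]) -> has_lbound (f @` `[0, 1]) ->
  measurable_fun (`[0, 1] : set C) (f : C -> R).
Proof.
move=> If ubf lbf.
have /choice[lo /choice[gap bracket]] : forall n, exists lo gap : R -> R,
  [/\ measurable_fun setT lo, measurable_fun setT gap,
      forall y, 0 <= gap y,
      forall y, y \in `[0, 1[ -> lo y <= f y <= lo y + gap y &
      (\int[mu]_y (gap y)%:E < n.+1%:R^-1%:E)%E].
  by move=> n; exact: riemann_integrable_borel_bracket.
pose L (y : R) : R := sup (range (lo ^~ y)).
pose w (y : R) : R := inf (range (gap ^~ y)).
(* This writes [L] and [w] as [sups] and [infs] at index 0, for which measurability lemmas exist. *)
have sdrop0 (u : R^nat) : sdrop u 0 = range u.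
  by apply/seteqP; split=> [_ [k _ <-]|_ [k _ <-]]; exists k.
have subI : `[0, 1[%classic `<=` (`[0, 1]%classic : set R).
  by apply: subset_itvl; rewrite bnd_simp.
have loub y : y \in `[0, 1[ -> has_ubound (range (lo ^~ y)).
  move=> y01; exists (f y) => _ [n _ <-].
  by have [_ _ _ /(_ _ y01)/andP[]] := bracket n.
have mL : measurable_fun (`[0, 1[ : set R) L.
  have -> : L = fun y => sups (lo ^~ y) 0.
    by apply/funext => y; rewrite /sups/= sdrop0.
  apply: measurable_fun_sups => [y /loub//|n].
  by have [+ _ _ _ _] := bracket n => /measurable_funTS; exact.
have gaplb y : has_lbound (range (gap ^~ y)).
  by exists 0 => _ [n _ <-]; have [_ _ + _ _] := bracket n; exact.
have mw : measurable_fun setT w.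
  have -> : w = fun y => infs (gap ^~ y) 0.
    by apply/funext => y; rewrite /infs/= sdrop0.
  apply: measurable_fun_infs => [y _//|n].
  by have [_ + _ _ _] := bracket n.
have w0 y : 0 <= w y.
  apply: lb_le_inf; first by exists (gap 0 y), 0.
  by move=> _ [n _ <-]; have [_ _ + _ _] := bracket n; exact.
have wgap n y : w y <= gap n y by apply: ge_inf => //; exists n.
have fL y : y \in `[0, 1[ -> 0 <= f y - L y <= w y.
  move=> y01; rewrite subr_ge0; apply/andP; split.
    apply: ge_sup; first by exists (lo 0 y), 0.
    by move=> _ [n _ <-]; have [_ _ _ /(_ _ y01)/andP[]] := bracket n.
  apply: lb_le_inf; first by exists (gap 0 y), 0.
  move=> _ [n _ <-]; have [_ _ _ /(_ _ y01)/andP[_ h] _] := bracket n.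
  rewrite lerBlDl (le_trans h)// lerD2r.
  by apply: ub_le_sup; [exact: loub|exists n].
have Iw : (\int[mu]_y `|(w y)%:E| = 0)%E.
  apply/eqP; rewrite eq_le integral_ge0// andbT.
  apply/lee_addgt0Pr => e e0; rewrite add0e.
  have [n ne] : exists n, n.+1%:R^-1 < e.
    exists (Num.truncn e^-1); rewrite invf_plt ?posrE// truncnS_gt//.
  have [_ mg g0 _ /ltW gn] := bracket n.
  apply: le_trans (le_trans gn _); last by rewrite lee_fin ltW.
  apply: ge0_le_integral => //.
  - by apply: measurableT_comp => //; exact/measurable_EFinP.
  - exact/measurable_EFinP.
  - by move=> y _; rewrite lee_fin ger0_norm.
have : ae_eq mu setT (EFin \o w) (cst 0%E).
  by apply/ae_eq_integral_abs => //; exact/measurable_EFinP.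
move=> [Z [mZ Z0 wZ]].
(* Since the completed measure is complete, equality with the Borel function [L] outside the null
   set [Z] makes [f] measurable. *)
have mf : measurable_fun (`[0, 1[ : set C) (f : C -> R).
  apply/measurable_EFinP.
  apply: (ae_measurable_fun completed_lebesgue_measure_is_complete
    (f := EFin \o L)).
    exists Z; split => //; first exact: measurable_completed.
    move=> y /= h; apply: wZ => /= wy0; apply: h => y01.
    have := fL y y01; have [->] := wy0 I; rewrite -eq_le eq_sym subr_eq0.
    by move=> /eqP ->.
  apply/measurable_EFinP => _ B mB.
  by apply: measurable_completed; exact: mL.
have -> : `[0, 1]%classic = `[0, 1[%classic `|` [set 1] :> set C.
  by rewrite setUitv1// bnd_simp.
apply/measurable_funU => //; [exact: measurable_completed..|].
by split => //; exact: measurable_fun_set1.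
Qed.

End completed_lebesgue.

(** * Asymptotics of beta *)

Section power_integral.
Context d (T : measurableType d) (R : realType).
Variables (m : {measure set T -> \bar R}) (D : set T) (f : T -> R) (a b : R).
Hypotheses (mD : measurable D) (D1 : m D = 1%E) (mf : measurable_fun D f).
Hypotheses (a0 : 0 < a) (fab : forall y, D y -> a <= f y <= b).

Let f0 y : D y -> 0 < f y.
Proof. by move=> /fab/andP[/(lt_le_trans a0)]. Qed.

Let mpow x : measurable_fun D (fun y => (f y `^ x)%:E).
Proof.
by apply/measurable_EFinP; exact: (measurableT_comp (measurable_powR x)).
Qed.

Lemma integral_powR_le_cst x : 0 <= x ->
  (\int[m]_(y in D) (f y `^ x)%:E <= (b `^ x)%:E)%E.
Proof.
move=> x0; apply: (@le_trans _ _ (\int[m]_(y in D) (cst (b `^ x)%:E) y)%E).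
  2: by rewrite integral_cst// D1 mule1.
apply: ge0_le_integral => //; first by move=> y _; rewrite lee_fin powR_ge0.
move=> y Dy; have /andP[_ fb] := fab y Dy.
have fy := f0 y Dy.
by rewrite lee_fin ge0_ler_powR// nnegrE ltW// (lt_le_trans fy).
Qed.

Lemma integral_powR_fin_num x : 0 <= x ->
  (\int[m]_(y in D) (f y `^ x)%:E)%E \is a fin_num.
Proof.
move=> x0; rewrite ge0_fin_numE.
  by apply: le_lt_trans (integral_powR_le_cst x x0) _; rewrite ltry.
by apply: integral_ge0 => y _; rewrite lee_fin powR_ge0.
Qed.

Lemma integral_powR_ge_on (A : set T) x k : 0 <= x -> measurable A ->
  A `<=` D -> 0 <= k -> (forall y, A y -> k <= f y `^ x) ->
  (k%:E * m A <= \int[m]_(y in D) (f y `^ x)%:E)%E.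
Proof.
move=> x0 mA AD k0 kf; rewrite -integral_cst//.
apply: (@le_trans _ _ (\int[m]_(y in A) (f y `^ x)%:E)%E).
  apply: ge0_le_integral => //.
  exact: measurable_funS AD (mpow x).
apply: ge0_subset_integral => //.
by move=> y _; rewrite lee_fin powR_ge0.
Qed.

Lemma integral_powR_gt0 x : 0 <= x -> (0 < \int[m]_(y in D) (f y `^ x)%:E)%E.
Proof.
move=> x0; have : ((a `^ x)%:E * m D <= \int[m]_(y in D) (f y `^ x)%:E)%E.
  apply: integral_powR_ge_on => //; first exact: powR_ge0.
  move=> y Dy; have /andP[? _] := fab y Dy.
  by rewrite ge0_ler_powR// nnegrE ltW// f0.
by rewrite D1 mule1; apply: lt_le_trans; rewrite lte_fin powR_gt0.
Qed.

Lemma integral_powR_le_integral (g : T -> R) x : measurable_fun D g ->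
  (forall y, D y -> f y `^ x <= g y) ->
  (\int[m]_(y in D) (f y `^ x)%:E <= \int[m]_(y in D) (g y)%:E)%E.
Proof.
move=> mg fg; apply: ge0_le_integral => //.
  by move=> y _; rewrite lee_fin powR_ge0.
exact/measurable_EFinP.
Qed.

End power_integral.

(** * General bounds on [beta], and the case of a flat maximum *)

Section beta_estimates.
Context {R : realType}.
Local Notation mu := (@lebesgue_measure R).
Local Notation cmu := (@completed_lebesgue_measure R).
Local Notation C := (caratheodory_type (wlength (@idfun R))^*%mu).
Local Notation I01 := (`[0, 1]%classic : set C).

Lemma measurable_I01 : measurable I01.
Proof. exact: measurable_completed. Qed.

Lemma completed_measure_I01 : cmu I01 = 1%E.
Proof.
by rewrite completed_lebesgue_measureE lebesgue_measure_itv/= lte01 oppr0 adde0.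
Qed.

Variable f : R -> R.
Hypothesis Ff : class_F f.

Lemma class_F_bounds y : y \in `[0, 1] -> M_minus f <= f y <= M_plus f.
Proof.
move=> y01; apply/andP; split.
  apply: ge_inf; last by exists y.
  by exists 0 => _ [z z01 <-]; exact: ltW (class_F_gt0 Ff _).
by apply: ub_le_sup; [exact: class_F_sup Ff|exists y].
Qed.

Lemma M_plus_gt0 : 0 < M_plus f.
Proof.
have h : (0 : R) \in `[0, 1] by rewrite in_itv/= lexx ler01.
have /andP[h1 h2] := class_F_bounds 0 h.
exact: lt_le_trans (class_F_inf Ff) (le_trans h1 h2).
Qed.

Lemma measurable_class_F : measurable_fun I01 (f : C -> R).
Proof.
apply: riemann_integrable_measurable; [exact: class_F_riemann Ff|
  exact: class_F_sup Ff|].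
by exists 0 => _ [z z01 <-]; exact: ltW (class_F_gt0 Ff _).
Qed.

Let fM y : I01 y -> M_minus f <= f y <= M_plus f.
Proof. exact: class_F_bounds. Qed.

(** Boundedness of [f] makes the integral finite, so comparisons of extended-real integrals pass to
    the real number [beta f x]. *)
Lemma EFin_beta x : 0 <= x ->
  (\int[cmu]_(y in I01) (f y `^ x)%:E)%E = (beta f x)%:E.
Proof.
move=> x0; rewrite /beta/Rintegral fineK//.
exact: (@integral_powR_fin_num _ _ _ cmu I01 f _ _ measurable_I01
  completed_measure_I01 measurable_class_F (class_F_inf Ff) fM).
Qed.

Lemma beta_le_cst x : 0 <= x -> beta f x <= M_plus f `^ x.
Proof.
move=> x0; rewrite -lee_fin -EFin_beta//.
exact: (@integral_powR_le_cst _ _ _ cmu I01 f _ _ measurable_I01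
  completed_measure_I01 measurable_class_F (class_F_inf Ff) fM).
Qed.

(** Source of both lower bounds on [beta]: [A] will be the set of maximum points, or a short
    interval near [ystar]. *)
Lemma beta_ge_on (A : set C) x k : 0 <= x -> measurable A -> A `<=` I01 ->
  0 <= k -> (forall y, A y -> k <= f y `^ x) ->
  (k%:E * cmu A <= (beta f x)%:E)%E.
Proof.
move=> x0 mA AI k0 kf; rewrite -EFin_beta//.
exact: (@integral_powR_ge_on _ _ _ cmu I01 f measurable_I01
  measurable_class_F _ x k x0 mA AI k0 kf).
Qed.

(** The majorant is Borel, so its integral can be taken against [mu], where a primitive is
    available. *)
Lemma beta_le_integral (g : R -> R) x : 0 <= x -> measurable_fun setT g ->
  (forall y, y \in `[0, 1] -> f y `^ x <= g y) ->
  ((beta f x)%:E <= \int[mu]_(y in `[0%R, 1%R]) (g y)%:E)%E.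
Proof.
move=> x0 mg fg; rewrite -EFin_beta// -ge0_integral_completed//; last first.
  by move=> y y01; apply: le_trans (fg y y01); exact: powR_ge0.
exact: (@integral_powR_le_integral _ _ _ cmu I01 f measurable_I01
  measurable_class_F g x (measurable_fun_completed _ _ mg) fg).
Qed.

Lemma beta_gt0 x : 0 <= x -> 0 < beta f x.
Proof.
move=> x0; rewrite -lte_fin -EFin_beta//.
exact: (@integral_powR_gt0 _ _ _ cmu I01 f _ _ measurable_I01
  completed_measure_I01 measurable_class_F (class_F_inf Ff) fM).
Qed.

Lemma beta_order_flat_max :
  (0 < cmu [set y : R | y \in `[0%R, 1%R] /\ f y = M_plus f])%E ->
  asymp_order (pinfty_nbhs R) (beta f) (fun x : R => M_plus f `^ x).
Proof.
set A := [set y | _] => A0.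
have AI : A `<=` I01 by move=> y [].
have mA : measurable (A : set C).
  have -> : A = I01 `&` f @^-1` [set M_plus f] by [].
  by apply: measurable_class_F => //; exact: measurable_I01.
have Afin : cmu A \is a fin_num.
  rewrite ge0_fin_numE ?measure_ge0//.
  have /le_lt_trans : (cmu A <= cmu I01)%E.
    by apply: le_measure => //; rewrite inE//; exact: measurable_I01.
  by rewrite completed_measure_I01; apply; rewrite ltry.
apply: (@bounds_asymp_order _ _ _ _ _ (fine (cmu A)) 1).
  by rewrite fine_gt0// A0 ltey_eq Afin.
near=> x; have x0 : 0 <= x by near: x; exact: nbhs_pinfty_ge.
split; first by rewrite powR_gt0// M_plus_gt0.
rewrite mul1r beta_le_cst// andbT.
rewrite -lee_fin mulrC EFinM fineK//.
apply: beta_ge_on => //; first exact: powR_ge0.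
by move=> y [_ ->].
Unshelve. all: by end_near. Qed.

End beta_estimates.

(** * Analytic estimates for a maximum of power type *)

Section peak.
Context {R : realType}.
Implicit Types (a h k s u x y z : R).

(** As exp(2u) >= 1 + 2u, the product (1 - u) exp(2u) is at least 1 + u - 2u^2, which is at least 1
    when u <= 1/2. *)
Lemma onem_ge_expR u : 0 <= u <= 2^-1 -> expR (- (2 * u)) <= 1 - u.
Proof.
move=> /andP[u0 u2]; have e0 := expR_gt0 (2 * u).
rewrite expRN -div1r ler_pdivrMr//.
have := expR_ge1Dx (2 * u); nra.
Qed.

(** With w = (k a / 2) s^a one has exp(k s^a) = exp(w)^(2/a) >= w^(2/a) = A s^2. Together with exp(k
    s^a) >= 1 this gives K = 1 + 1/A. *)
Lemma expR_powR_le_cauchy k a : 0 < k -> 0 < a ->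
  exists2 K, 0 < K &
    forall s, 0 <= s -> expR (- (k * s `^ a)) <= K / (1 + s ^+ 2).
Proof.
move=> k0 a0; pose A := (k * a / 2) `^ (2 / a).
have A0 : 0 < A by rewrite powR_gt0// !mulr_gt0// invr_gt0.
exists (1 + A^-1) => [|s s0]; first by rewrite ltr_wpDr// invr_ge0 ltW.
have s20 : 0 < 1 + s ^+ 2 by rewrite ltr_pwDl// sqr_ge0.
rewrite ler_pdivlMr// mulrC expRN ler_pdivrMr ?expR_gt0//.
set E := expR _; have E1 : 1 <= E.
  by rewrite -expR0 ler_expR mulr_ge0 ?powR_ge0// ltW.
suff sE : s ^+ 2 <= A^-1 * E by rewrite mulrDl mul1r lerD.
rewrite ler_pdivlMl//.
pose w := k * a / 2 * s `^ a.
have w0 : 0 <= w by rewrite !mulr_ge0 ?powR_ge0// ltW// invr_gt0.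
have -> : A * s ^+ 2 = w `^ (2 / a).
  rewrite /w powRM ?powR_ge0//; last by rewrite !mulr_ge0// ltW// invr_gt0.
  have -> : (s `^ a) `^ (2 / a) = s `^ 2%:R.
    by rewrite -powRrM; congr (_ `^ _); field; rewrite gt_eqF.
  by rewrite powR_mulrn.
have -> : E = expR w `^ (2 / a).
  rewrite -expRM; congr expR; rewrite /w; field.
  by rewrite gt_eqF.
apply: ge0_ler_powR; rewrite ?nnegrE ?expR_ge0//.
  by rewrite divr_ge0// ltW.
by apply: le_trans (expR_ge1Dx w); rewrite lerDr.
Qed.

Lemma is_derive_scaled_atan z h y : 0 < h ->
  is_derive y 1 (fun t : R => h * atan (h^-1 * (t - z)))
    (1 + (h^-1 * (y - z)) ^+ 2)^-1.
Proof.
move=> h0.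
apply: is_derive_eq.
by rewrite /GRing.scale/= subr0 mulr1 mulrCA divff ?gt_eqF// mulr1.
Qed.

Lemma continuous_cauchy z h :
  continuous (fun y : R => (1 + (h^-1 * (y - z)) ^+ 2)^-1).
Proof.
move=> t; apply: cvgV; first by rewrite gt_eqF// ltr_pwDl// sqr_ge0.
pose G (y : R) := 1 + (h^-1 * (y - z)) ^+ 2.
have dG : derivable G t 1 by rewrite /G; exact: ex_derive.
by apply: (differentiable_continuous (f := G)); exact/derivable1_diffP.
Qed.

(** A primitive is h atan((t - z) / h), and the arctangent varies by less than pi. *)
Lemma integral_cauchy_le z h : 0 < h ->
  (\int[lebesgue_measure]_(y in `[0%R, 1%R])
     ((1 + (h^-1 * (y - z)) ^+ 2)^-1)%:E <= (h * pi)%:E)%E.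
Proof.
move=> h0.
pose F t := h * atan (h^-1 * (t - z)).
have dF t : derivable F t 1 by have [] := is_derive_scaled_atan z h t h0.
have cF : continuous F.
  by move=> t; apply: differentiable_continuous; exact/derivable1_diffP.
rewrite (@continuous_FTC2 _ _ F)//.
- rewrite -EFinB lee_fin /F -mulrBr ler_pM2l//.
  have := atan_ltpi2 (h^-1 * (1 - z)).
  have := atan_gtNpi2 (h^-1 * (0 - z)); lra.
- apply: continuous_subspaceT => t.
  exact: continuous_cauchy.
- split=> [y _| |].
  + exact: dF.
  + exact: cvg_at_right_filter (cF 0).
  + exact: cvg_at_left_filter (cF 1).
- move=> t _; rewrite derive1E.
  by have [_ ->] := is_derive_scaled_atan z h t h0.
Qed.

End peak.

(** * Order of [beta] at a maximum of power type *)

Section beta_peak.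
Context {R : realType}.
Variable f : R -> R.
Hypothesis Ff : class_F f.
Variables ystar alpha : R.
Hypotheses (ys01 : ystar \in `[0, 1]) (a0 : 0 < alpha).
Hypothesis fmax : f ystar = M_plus f.

Let M := M_plus f.
Let M0 : 0 < M. Proof. exact: M_plus_gt0. Qed.

Let powR_0a : (0 : R) `^ alpha = 0.
Proof. by rewrite powR0// gt_eqF. Qed.

Lemma peak_near :
  asymp_order (within `[0, 1] ystar^') (fun y => f ystar - f y)
    (fun y => `|y - ystar| `^ alpha) ->
  exists c C d, [/\ 0 < c, 0 < C, 0 < d & forall y, y \in `[0, 1] ->
    `|y - ystar| < d ->
    c * `|y - ystar| `^ alpha <= M - f y <= C * `|y - ystar| `^ alpha].
Proof.
move=> /asymp_order_bounds[c c0 [C C0]]; rewrite /prop_near1/within/=.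
move=> /nbhs_ballP[d /= d0 dP]; exists c, C, d; split => // y y01 yd.
(* The punctured neighbourhood gives no information at [ystar] itself, where all three terms
   vanish. *)
have [->|yys] := eqVneq y ystar.
  by rewrite fmax !subrr normr0 powR_0a !mulr0 lexx.
have /(_ yys y01) : y != ystar -> y \in `[0, 1] ->
    c <= (f ystar - f y) / `|y - ystar| `^ alpha <= C.
  by move=> h1 h2; apply: dP => //; rewrite /ball/= distrC.
have n0 : 0 < `|y - ystar| `^ alpha.
  by rewrite powR_gt0// normr_gt0 subr_eq0.
by rewrite ler_pdivlMr// ler_pdivrMr// fmax.
Qed.

(** Outside the ball the gap M - f is at least e, while |y - ystar|^alpha <= 1 on the unit interval;
    hence k = min(c, e) works everywhere. *)
Lemma peak_global c d : 0 < c -> 0 < d ->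
  (forall y, y \in `[0, 1] -> `|y - ystar| < d ->
    c * `|y - ystar| `^ alpha <= M - f y) ->
  (forall U : set R, nbhs ystar U -> exists2 e : R, 0 < e &
     forall y : R, y \in `[0, 1] -> ~ U y -> f y <= M - e) ->
  exists2 k, 0 < k & forall y, y \in `[0, 1] ->
    k * `|y - ystar| `^ alpha <= M - f y.
Proof.
move=> c0 d0 cP away.
have [e e0 eP] := away _ (nbhsx_ballx ystar d d0).
exists (Num.min c e) => [|y y01]; first by rewrite lt_min c0.
have [yd|yd] := ltP `|y - ystar| d.
  apply: le_trans (cP y y01 yd).
  by rewrite ler_wpM2r ?powR_ge0// ge_min lexx.
have nb : ~ ball ystar d y.
  by rewrite /ball/= distrC => /lt_le_trans/(_ yd); rewrite ltxx.
have /(_ nb) fe := eP y y01.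
apply: (@le_trans _ _ e); last by rewrite lerBrDl addrC -lerBrDl.
have y1 : `|y - ystar| <= 1.
  move: y01 ys01; rewrite !in_itv/= => /andP[? ?] /andP[? ?].
  by rewrite ler_norml; lra.
have p1 : `|y - ystar| `^ alpha <= 1.
  apply: (@le_trans _ _ (1 `^ alpha)); last by rewrite powR1.
  by rewrite ge0_ler_powR ?nnegrE// ltW.
rewrite (@le_trans _ _ (Num.min c e * 1))//.
  by rewrite ler_pM2l// lt_min c0.
by rewrite mulr1 ge_min lexx orbT.
Qed.

Lemma beta_peak_upper k : 0 < k ->
  (forall y, y \in `[0, 1] -> k * `|y - ystar| `^ alpha <= M - f y) ->
  exists2 K, 0 < K & forall x, 0 < x ->
    beta f x <= K * (x `^ (- alpha^-1) * M `^ x).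
Proof.
move=> k0 kP; have kM0 : 0 < k / M by rewrite divr_gt0.
have [K K0 KP] := expR_powR_le_cauchy (k / M) alpha kM0 a0.
exists (K * pi) => [|x x0]; first by rewrite mulr_gt0// pi_gt0.
pose h := x `^ (- alpha^-1).
have h0 : 0 < h by rewrite powR_gt0.
(* The scale [h] satisfies h^alpha = 1/x, so the factor [x] is absorbed by rescaling [t]. *)
have hx (t : R) : 0 <= t -> x * t `^ alpha = (h^-1 * t) `^ alpha.
  move=> t0; rewrite powRM// ?invr_ge0 ?ltW//; congr (_ * _).
  rewrite /h -powRN opprK -powRrM mulVf ?gt_eqF//.
  by rewrite powRr1// ltW.
pose g (y : R) := M `^ x * K * (1 + (h^-1 * (y - ystar)) ^+ 2)^-1.
have fg y : y \in `[0, 1] -> f y `^ x <= g y.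
  move=> y01; have f0 := class_F_gt0 Ff y01.
  have := kP y y01; set t := `|y - ystar| => kt.
  (* This is 1 - u <= exp(-u) with u = (k / M) t^alpha. *)
  have fexp : f y <= M * expR (- (k / M * t `^ alpha)).
    rewrite mulrC -ler_pdivrMr//.
    apply: le_trans (expR_ge1Dx _).
    rewrite ler_pdivrMr// mulrDl mul1r mulNr mulrAC divfK ?gt_eqF//.
    by lra.
  apply: (@le_trans _ _ ((M * expR (- (k / M * t `^ alpha))) `^ x)).
    by apply: ge0_ler_powR => //; rewrite ?nnegrE ltW// mulr_gt0// expR_gt0.
  rewrite powRM ?expR_ge0// ?(ltW M0)// /g.
  rewrite -[M `^ x * K * _]mulrA ler_pM2l ?powR_gt0//.
  have -> : expR (- (k / M * t `^ alpha)) `^ x =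
      expR (- (k / M * (h^-1 * t) `^ alpha)).
    by rewrite -expRM -hx ?normr_ge0//; congr expR; ring.
  have ht0 : 0 <= h^-1 * t by rewrite mulr_ge0 ?normr_ge0// invr_ge0 ltW.
  apply: le_trans (KP _ ht0) _.
  by rewrite /t !exprMn real_normK// num_real.
have mG : measurable_fun setT
    (fun y : R => (1 + (h^-1 * (y - ystar)) ^+ 2)^-1).
  by apply: continuous_measurable_fun; exact: continuous_cauchy.
have mg : measurable_fun setT g by exact: measurable_funM.
rewrite -lee_fin.
apply: le_trans (beta_le_integral f Ff g x (ltW x0) mg fg) _.
rewrite /g; under eq_integral do rewrite EFinM.
rewrite ge0_integralZl_EFin//; last 3 first.
- by move=> y _; rewrite lee_fin invr_ge0 addr_ge0// sqr_ge0.
- by apply/measurable_EFinP; apply: measurable_funTS; exact: mG.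
- by rewrite mulr_ge0 ?powR_ge0// ltW.
have -> : K * pi * (x `^ (- alpha^-1) * M `^ x) = M `^ x * K * (h * pi).
  by rewrite /h; ring.
rewrite [leRHS]EFinM lee_pmul2l ?lte_fin//; first exact: integral_cauchy_le.
by rewrite mulr_gt0 ?powR_gt0.
Qed.

(** Within distance h = x^(-1/alpha) of [ystar] one has f >= M (1 - C / (M x)), hence f^x >= M^x
    exp(-2C/M). An interval of length h in this zone supplies the factor x^(-1/alpha). *)
Lemma beta_peak_lower C d : 0 < C -> 0 < d ->
  (forall y, y \in `[0, 1] -> `|y - ystar| < d ->
    M - f y <= C * `|y - ystar| `^ alpha) ->
  \forall x \near +oo,
    expR (- (2 * (C / M))) * (x `^ (- alpha^-1) * M `^ x) <= beta f x.
Proof.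
move=> C0 d0 CP; near=> x.
have x0 : 0 < x by near: x; exact: nbhs_pinfty_gt.
pose h := x `^ (- alpha^-1).
have h0 : 0 < h by rewrite powR_gt0.
have hx : h `^ alpha = x^-1.
  by rewrite /h -powRrM mulNr mulVf ?gt_eqF// powR_inv1// ltW.
have small r : 0 < r -> (r `^ alpha)^-1 < x -> h < r.
  move=> r0 rx; rewrite ltNge; apply/negP => rh.
  have : r `^ alpha <= h `^ alpha.
    by apply: ge0_ler_powR => //; rewrite ?nnegrE ltW.
  by rewrite hx leNgt invf_plt ?posrE ?powR_gt0// rx.
have hd : h < d.
  apply: small => //; near: x; exact: nbhs_pinfty_gt.
have h2 : h < 2^-1.
  apply: small; first by rewrite invr_gt0.
  near: x; exact: nbhs_pinfty_gt.
have uM : C / M / x <= 2^-1.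
  by rewrite ler_pdivrMr// -ler_pdivrMl ?invr_gt0.
(* The interval is placed to the right of [ystar] if [ystar] is at most 1/2 and to its left
   otherwise; h < 1/2 keeps it inside the unit interval. *)
have [a [a01 aP]] : exists a, [/\ `[a, a + h]%classic `<=` `[0, 1]%classic &
    forall y, a <= y <= a + h -> `|y - ystar| <= h].
  move: ys01; rewrite in_itv/= => /andP[ys0 ys1].
  have [yh|yh] := lerP ystar 2^-1.
    exists ystar; split => y; rewrite /= ?in_itv/= => /andP[? ?].
      by apply/andP; split; lra.
    by rewrite ler_norml; lra.
  exists (ystar - h); split => y; rewrite /= ?in_itv/= => /andP[? ?].
    by apply/andP; split; lra.
  by rewrite ler_norml; lra.
pose k := M `^ x * expR (- (2 * (C / M))).
have k0 : 0 <= k by rewrite mulr_ge0 ?powR_ge0 ?expR_ge0.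
have kP y : `[a, a + h]%classic y -> k <= f y `^ x.
  move=> ay; have y01 : y \in `[0, 1] by exact: a01.
  have yh : `|y - ystar| <= h by apply: aP; move: ay; rewrite /= in_itv.
  have := CP y y01 (le_lt_trans yh hd) => fC.
  have {}fC : M - f y <= C / x.
    apply: le_trans fC _; rewrite ler_pM2l// -hx.
    by apply: ge0_ler_powR; rewrite ?nnegrE// ltW.
  have u02 : 0 <= C / M / x <= 2^-1.
    by rewrite uM andbT !divr_ge0 ?ltW.
  have fe : M * expR (- (2 * (C / M / x))) <= f y.
    apply: (@le_trans _ _ (M * (1 - C / M / x))).
      by rewrite ler_pM2l// onem_ge_expR.
    have -> : M * (1 - C / M / x) = M - C / x.
      by field; rewrite !gt_eqF.
    by lra.
  have -> : k = (M * expR (- (2 * (C / M / x)))) `^ x.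
    rewrite powRM ?expR_ge0 ?(ltW M0)// -expRM /k; congr (_ * expR _).
    by field; rewrite !gt_eqF.
  have fy0 := class_F_gt0 Ff y01.
  apply: ge0_ler_powR; rewrite ?nnegrE ?(ltW x0) ?(ltW fy0)//.
  by rewrite mulr_ge0 ?expR_ge0 ?(ltW M0).
have := beta_ge_on f Ff `[a, a + h]%classic x k (ltW x0)
  (measurable_completed _ (measurable_itv _)) a01 k0 kP.
rewrite completed_lebesgue_measureE lebesgue_measure_itv/= lte_fin ltrDl h0.
rewrite -EFinD addrAC subrr add0r -EFinM lee_fin /k; apply: le_trans.
by rewrite le_eqVlt -/h; apply/orP; left; apply/eqP; ring.
Unshelve. all: by end_near. Qed.

Lemma beta_order_peak :
  asymp_order (within `[0, 1] ystar^') (fun y => f ystar - f y)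
    (fun y => `|y - ystar| `^ alpha) ->
  (forall U : set R, nbhs ystar U -> exists2 e : R, 0 < e &
     forall y : R, y \in `[0, 1] -> ~ U y -> f y <= M_plus f - e) ->
  asymp_order (pinfty_nbhs R) (beta f)
    (fun x : R => x `^ (- alpha^-1) * M_plus f `^ x).
Proof.
move=> /peak_near[c [C [d [c0 C0 d0 dP]]]] away.
have dcP y : y \in `[0, 1] -> `|y - ystar| < d ->
    c * `|y - ystar| `^ alpha <= M - f y.
  by move=> y01 yd; have /andP[] := dP y y01 yd.
have [k k0 kP] := peak_global c d c0 d0 dcP away.
have [K K0 KP] := beta_peak_upper k k0 kP.
apply: (@bounds_asymp_order _ _ _ _ _ (expR (- (2 * (C / M)))) K).
  exact: expR_gt0.
have dCP y : y \in `[0, 1] -> `|y - ystar| < d ->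
    M - f y <= C * `|y - ystar| `^ alpha.
  by move=> y01 yd; have /andP[] := dP y y01 yd.
near=> x; have x0 : 0 < x by near: x; exact: nbhs_pinfty_gt.
split; first by rewrite mulr_gt0 ?powR_gt0.
rewrite KP// andbT; near: x.
exact: beta_peak_lower C d C0 d0 dCP.
Unshelve. all: by end_near. Qed.

End beta_peak.

(** * Stirling bounds *)

Section stirling.
Context {R : realType}.
Implicit Types (u : R) (n : nat).

Lemma ge0_derive_ge1 (g dg : R -> R) : g 1 = 0 ->
  (forall u, 1 <= u -> is_derive u 1 g (dg u)) ->
  (forall u, 1 <= u -> 0 <= dg u) -> forall u, 1 <= u -> 0 <= g u.
Proof.
move=> g1 dgP dg0 u u1.
have [] := @MVT_segment R g dg 1 u u1.
- by move=> x; rewrite in_itv/= => /andP[/ltW/dgP].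
- apply: derivable_within_continuous => x; rewrite in_itv/= => /andP[x1 _].
  by have [] := dgP x x1.
move=> c; rewrite in_itv/= => /andP[c1 _]; rewrite g1 subr0 => ->.
by rewrite mulr_ge0 ?dg0// subr_ge0.
Qed.

(** The difference vanishes at 1 and has derivative (u - 1)^2 / (u (u + 1)^2). *)
Lemma ln_ge_pade u : 1 <= u -> 2 - 4 * (u + 1)^-1 <= ln u.
Proof.
move=> u1; rewrite -subr_ge0; move: u u1.
apply: (@ge0_derive_ge1 _ (fun u => u^-1 - 4 * (u + 1) ^- 2)).
- by rewrite ln1; field.
- move=> u u1; have u0 : 0 < u by apply: lt_le_trans u1.
  have dln := is_derive1_ln u0.
  have u10 : u + 1 != 0 by rewrite gt_eqF// addr_gt0.
  have dinv : is_derive u 1 (fun y : R => (y + 1)^-1) (- (u + 1) ^- 2).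
    have d1 : is_derive u 1 (fun y : R => y + 1) (1 : R).
      by apply: is_derive_eq; rewrite addr0.
    have := @is_deriveV R (fun y : R => y + 1) u 1 1 u10 d1.
    by rewrite /GRing.scale/= mulr1.
  apply: is_derive_eq.
  by rewrite /GRing.scale/=; ring.
- move=> u u1; have u0 : 0 < u by apply: lt_le_trans u1.
  have -> : u^-1 - 4 * (u + 1) ^- 2 = (u - 1) ^+ 2 / (u * (u + 1) ^+ 2).
    by field; rewrite !gt_eqF// addr_gt0.
  by rewrite divr_ge0 ?sqr_ge0// mulr_ge0 ?sqr_ge0// ltW.
Qed.

(** The difference vanishes at 1 and has derivative (1 - 1/u)^2 / 2. *)
Lemma ln_le_trapezoid u : 1 <= u -> ln u <= 2^-1 * (u - u^-1).
Proof.
move=> u1; rewrite -subr_ge0; move: u u1.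
apply: (@ge0_derive_ge1 _ (fun u => 2^-1 * (1 + u ^- 2) - u^-1)).
- by rewrite ln1; field.
- move=> u u1; have u0 : 0 < u by apply: lt_le_trans u1.
  have dln := is_derive1_ln u0.
  have u10 : u != 0 by rewrite gt_eqF.
  have dinv : is_derive u 1 (fun y : R => y^-1) (- u ^- 2).
    have := @is_deriveV R id u 1 1 u10 (is_derive_id _ _).
    by rewrite /GRing.scale/= mulr1.
  apply: is_derive_eq.
  by rewrite /GRing.scale/=; ring.
- move=> u u1; have u0 : 0 < u by apply: lt_le_trans u1.
  have -> : 2^-1 * (1 + u ^- 2) - u^-1 = (1 - u^-1) ^+ 2 / 2.
    by field; rewrite gt_eqF.
  by rewrite divr_ge0 ?sqr_ge0.
Qed.

(** Logarithm of the Stirling quotient n! / (sqrt(n) (n/e)^n). *)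
Let a n : R := ln n`!%:R + n%:R - (n%:R + 2^-1) * ln n%:R.

Let aS n : a n.+1 - a n.+2 =
  (n.+1%:R + 2^-1) * ln (n.+2%:R / n.+1%:R) - 1.
Proof.
rewrite /a (factS n.+1) natrM lnM ?posrE ?ltr0n ?fact_gt0//.
rewrite ln_div ?posrE ?ltr0n// -(natr1 n.+1).
by ring.
Qed.

(** At u = (z + 1)/z the lower bound on the logarithm is 1/(z + 1/2), which cancels the prefactor
    exactly. *)
Let aS_ge0 n : 0 <= a n.+1 - a n.+2.
Proof.
rewrite aS; have n0 : 0 < n.+1%:R :> R by [].
have : 1 <= n.+2%:R / n.+1%:R :> R by rewrite ler_pdivlMr// mul1r ler_nat.
move=> /ln_ge_pade; rewrite -(natr1 n.+1); move: n.+1%:R n0 => z z0 h.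
rewrite subr_ge0; apply: (@le_trans _ _ ((z + 2^-1) *
  (2 - 4 * ((z + 1) / z + 1)^-1))); last by rewrite ler_wpM2l// addr_ge0 ?ltW.
rewrite le_eqVlt; apply/orP; left; apply/eqP; field.
by rewrite !gt_eqF//; lra.
Qed.

(** At u = (z + 1)/z the upper bound times z + 1/2 is 1 + 1/(4 z (z + 1)), whose excess over 1
    telescopes. *)
Let aS_le n : a n.+1 - a n.+2 <= 4^-1 * (n.+1%:R^-1 - n.+2%:R^-1).
Proof.
rewrite aS; have n0 : 0 < n.+1%:R :> R by [].
have : 1 <= n.+2%:R / n.+1%:R :> R by rewrite ler_pdivlMr// mul1r ler_nat.
move=> /ln_le_trapezoid; rewrite -(natr1 n.+1); move: n.+1%:R n0 => z z0 h.
rewrite lerBlDr; apply: (@le_trans _ _ ((z + 2^-1) *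
  (2^-1 * ((z + 1) / z - ((z + 1) / z)^-1)))).
  by rewrite ler_wpM2l// addr_ge0 ?ltW.
rewrite le_eqVlt; apply/orP; left; apply/eqP; field.
by rewrite !gt_eqF//; lra.
Qed.

Lemma ln_fact_bounds n : (0 < n)%N -> 3 / 4 <=
  ln (n`!%:R : R) + n%:R - (n%:R + 2^-1) * ln n%:R <= 1.
Proof.
case: n => // n _; rewrite -/(a n.+1).
have a1 : a 1 = 1 by rewrite /a (_ : 1`! = 1)%N// ln1 mulr0 add0r subr0.
(* The induction carries the telescoped lower bound: starting from [a 1 = 1], the total decrease
   stays below 1/4. *)
suff : 1 - 4^-1 * (1 - n.+1%:R^-1) <= a n.+1 <= 1.
  have : 0 < n.+1%:R^-1 :> R by rewrite invr_gt0.
  move: n.+1%:R^-1 => r r0 /andP[h ->]; rewrite andbT (le_trans _ h)//.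
  by lra.
elim: n => [|n /andP[h1 h2]]; first by rewrite a1 lexx invr1; lra.
have := aS_ge0 n; have := aS_le n; move=> h3 h4.
move: (a n.+1) (a n.+2) n.+1%:R^-1 n.+2%:R^-1 h1 h2 h3 h4.
move=> x y r s h1 h2 h3 h4.
by apply/andP; split; lra.
Qed.

(** After exponentiation, [a n <= 1] yields the factor exp(-1) and [a n >= 3/4 > 0] yields the
    factor 1. *)
Lemma fact_stirling n : (0 < n)%N ->
  expR (- 1) * ((Num.sqrt n%:R)^-1 * expR (- n%:R * ln (n%:R / expR 1)))
    <= n`!%:R^-1 :> R /\
  n`!%:R^-1 <=
    (Num.sqrt n%:R)^-1 * expR (- n%:R * ln (n%:R / expR 1)) :> R.
Proof.
move=> n0; have n0R : 0 < n%:R :> R by rewrite ltr0n.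
have /andP[h1 h2] := ln_fact_bounds n n0.
have -> : (Num.sqrt n%:R)^-1 = expR (- (2^-1 * ln n%:R)) :> R.
  rewrite expRN; congr (_^-1).
  by rewrite -powR12_sqrt// /powR gt_eqF// .
have -> : n`!%:R^-1 = expR (- ln n`!%:R) :> R.
  by rewrite expRN lnK// posrE ltr0n fact_gt0.
rewrite ln_div ?posrE ?expR_gt0// expRK -!expRD !ler_expR.
by split; lra.
Qed.

End stirling.

(** * Tail of the friendship bias *)

Section composite_integral.
Context d (T : measurableType d) (R : realType).
Variables (m : {measure set T -> \bar R}) (D : set T) (f : T -> R).
Hypotheses (mD : measurable D) (mf : measurable_fun D f).

Let mcomp (g : R -> R) : measurable_fun setT g ->
  measurable_fun D (fun y => (g (f y))%:E).
Proof. by move=> mg; apply/measurable_EFinP; exact: (measurableT_comp mg). Qed.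

(** Turns pointwise inequalities between weights in z = f(y) into inequalities between mixed Poisson
    probabilities. *)
Lemma ge0_integral_comp_leZ (g h : R -> R) c : 0 <= c ->
  measurable_fun setT g -> measurable_fun setT h ->
  (forall y, D y -> 0 <= g (f y) <= c * h (f y)) ->
  (forall y, D y -> 0 <= h (f y)) ->
  (\int[m]_(y in D) (g (f y))%:E <= c%:E * \int[m]_(y in D) (h (f y))%:E)%E.
Proof.
move=> c0 mg mh gh h0; rewrite -ge0_integralZl_EFin//; last exact: mcomp.
apply: ge0_le_integral => //.
- by move=> y /gh/andP[]; rewrite lee_fin.
- exact: mcomp.
- under eq_fun do rewrite -EFinM.
  by apply: (mcomp (fun z => c * h z)); exact: measurable_funM.
- by move=> y /gh/andP[_]; rewrite -EFinM lee_fin.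
Qed.

End composite_integral.

(** * Degree laws of the root and of its children *)

Section offspring.
Context {R : realType}.
Local Notation cmu := (@completed_lebesgue_measure R).
Local Notation C := (caratheodory_type (wlength (@idfun R))^*%mu).
Local Notation I01 := (`[0, 1]%classic : set C).
Variables (f : R -> R) (lambda : R).
Hypotheses (Ff : class_F f) (lambda0 : 0 < lambda).

Let L := lambda * beta f 1.
Let M := M_plus f.
Let a := M_minus f.
Let b1 := beta f 1.

Let b10 : 0 < b1. Proof. exact: beta_gt0. Qed.
Let L0 : 0 < L. Proof. exact: mulr_gt0. Qed.
Let M0 : 0 < M. Proof. exact: M_plus_gt0. Qed.
Let a0 : 0 < a. Proof. exact: class_F_inf Ff. Qed.
Let fb y : I01 y -> a <= f y <= M. Proof. exact: class_F_bounds. Qed.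
Let f0 y : I01 y -> 0 < f y. Proof. by move=> /fb/andP[/(lt_le_trans a0)]. Qed.

(** Weights whose integrals over z = f(y) are the probabilities of degree [k]: [w0] for the root,
    whose type is uniform, and [w1] for a child, whose type has density f / beta_1. *)
Let w0 k (z : R) : R := poisson_pmf (L * z) k.
Let w1 k (z : R) : R := z / b1 * poisson_pmf (L * z) k.

Let mw0 k : measurable_fun setT (w0 k).
Proof.
apply: (measurableT_comp (f := fun r : R => poisson_pmf r k)).
  exact: measurable_poisson_pmf.
exact: mulrl_measurable.
Qed.

Let mw1 k : measurable_fun setT (w1 k).
Proof.
apply: measurable_funM; last exact: mw0.
exact: mulrr_measurable.
Qed.

Let pmfE k z : 0 < z -> poisson_pmf (L * z) k =
  (L * z) ^+ k * k`!%:R^-1 * expR (- (L * z)).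
Proof. by move=> z0; rewrite /poisson_pmf mulr_gt0. Qed.

(** Successive Poisson masses have ratio L z / (k + 1), and z <= M. *)
Let pmfS k z : 0 < z -> z <= M ->
  poisson_pmf (L * z) k.+1 <= L * M / k.+1%:R * poisson_pmf (L * z) k.
Proof.
move=> z0 zM; rewrite !pmfE// factS natrM invfM exprS.
set A := (L * z) ^+ k; set B := k`!%:R^-1; set E := expR _.
have -> : L * z * A * (k.+1%:R^-1 * B) * E = L * z / k.+1%:R * (A * B * E).
  by ring.
apply: ler_wpM2r.
  by rewrite !mulr_ge0 ?expR_ge0 ?invr_ge0// exprn_ge0// mulr_ge0// ltW.
by rewrite ler_wpM2r ?invr_ge0// ler_pM2l.
Qed.

Let LM0 k : 0 <= L * M / k.+1%:R.
Proof. by rewrite divr_ge0// mulr_ge0// ltW. Qed.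

Let J0 k := (\int[cmu]_(y in I01) (w0 k (f y))%:E)%E.
Let J1 k := (\int[cmu]_(y in I01) (w1 k (f y))%:E)%E.

Let mI : measurable I01. Proof. exact: measurable_I01. Qed.
Let mf : measurable_fun I01 (f : C -> R).
Proof. exact: measurable_class_F. Qed.

Let leZ := ge0_integral_comp_leZ _ C R cmu I01 f mI mf.

Let J0S k : (J0 k.+1 <= (L * M / k.+1%:R)%:E * J0 k)%E.
Proof.
apply: leZ => // y Iy; last exact: poisson_pmf_ge0.
by have /andP[_ fM] := fb y Iy; rewrite poisson_pmf_ge0 pmfS// f0.
Qed.

Let J1S k : (J1 k.+1 <= (L * M / k.+1%:R)%:E * J1 k)%E.
Proof.
have fb0 y : I01 y -> 0 <= f y / b1.
  by move=> Iy; rewrite divr_ge0// ltW// f0.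
apply: leZ => // y Iy; last first.
  by rewrite /w1 mulr_ge0 ?poisson_pmf_ge0 ?fb0.
have /andP[_ fM] := fb y Iy; rewrite /w1 mulr_ge0 ?poisson_pmf_ge0 ?fb0//=.
by rewrite [leRHS]mulrCA ler_wpM2l ?fb0// pmfS// f0.
Qed.

(** The factor exp(-L z) lies between exp(-L M) and 1. *)
Let pmf_le k z : a <= z <= M ->
  expR (- (L * M)) * (L ^+ k / k`!%:R * z ^+ k) <= poisson_pmf (L * z) k
    <= L ^+ k / k`!%:R * z ^+ k.
Proof.
move=> /andP[az zM]; have z0 : 0 < z by apply: lt_le_trans az.
rewrite pmfE// [(L * z) ^+ k]exprMn.
have -> : L ^+ k * z ^+ k / k`!%:R = L ^+ k / k`!%:R * z ^+ k by ring.
have W0 : 0 <= L ^+ k / k`!%:R * z ^+ k.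
  by rewrite !mulr_ge0 ?invr_ge0 ?exprn_ge0// ltW.
apply/andP; split.
  by rewrite mulrC ler_wpM2l// ler_expR lerN2 ler_pM2l.
by rewrite ler_piMr// -expR0 ler_expR oppr_le0 mulr_ge0// ltW.
Qed.

Let J0_1 : (0 < J0 1)%E.
Proof.
(* [e] is a lower bound for the Poisson mass at 1, uniform over a <= z <= M. *)
pose e := expR (- (L * M)) * (L * a).
have e0 : 0 < e by rewrite mulr_gt0 ?expR_gt0// mulr_gt0.
have E1 : (\int[cmu]_(y in I01) (cst (1%:E : \bar R) y) = 1)%E.
  by rewrite integral_cst// mul1e; exact: completed_measure_I01.
have h : (1 <= e^-1%:E * J0 1)%E.
  rewrite -E1; apply: (leZ (cst 1)) => //; first by rewrite invr_ge0 ltW.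
    move=> y Iy; rewrite ler01/= ler_pdivlMl// mulr1.
    have /andP[+ _] := pmf_le 1 (f y) (fb y Iy); apply: le_trans.
    rewrite /e ler_pM2l ?expR_gt0// !expr1 divr1 ler_pM2l//.
    by have /andP[] := fb y Iy.
  by move=> y Iy; exact: poisson_pmf_ge0.
rewrite ltNge; apply/negP => J0le.
have : (1%:E <= 0 :> \bar R)%E.
  by apply: le_trans h _; rewrite mule_ge0_le0// lee_fin invr_ge0 ltW.
by rewrite lee_fin ler10.
Qed.

(** The density factor f / beta_1 is at most M / beta_1, and what remains is L^n / n! times the
    integral of f^n. The reverse bound that follows uses f >= a and pays exp(-L M). *)
Let J1_beta_le n :
  (J1 n <= (M / b1 * (L ^+ n / n`!%:R) * beta f n%:R)%:E)%E.
Proof.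
have W0 : 0 <= L ^+ n / n`!%:R by rewrite divr_ge0 ?exprn_ge0// ltW.
rewrite EFinM -EFin_beta//.
apply: (leZ _ (fun z => z `^ n%:R)) => //.
- by rewrite mulr_ge0// divr_ge0// ltW.
- move=> y Iy; have /andP[_ fM] := fb y Iy; have fy := f0 y Iy.
  rewrite /w1 powR_mulrn ?(ltW fy)// mulr_ge0 ?poisson_pmf_ge0//=; last first.
    by rewrite divr_ge0// ltW.
  have /andP[_ h] := pmf_le n (f y) (fb y Iy).
  rewrite -[leRHS]mulrA.
  rewrite ler_pM ?poisson_pmf_ge0 ?divr_ge0 ?(ltW fy) ?(ltW b10)//.
  by rewrite ler_pM2r// invr_gt0.
- by move=> y Iy; exact: powR_ge0.
Qed.

Let beta_le_J1 n :
  ((a / b1 * expR (- (L * M)) * (L ^+ n / n`!%:R) * beta f n%:R)%:E <= J1 n)%E.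
Proof.
have W0 : 0 < L ^+ n / n`!%:R by rewrite divr_gt0 ?exprn_gt0// ltr0n fact_gt0.
pose c := a / b1 * expR (- (L * M)) * (L ^+ n / n`!%:R).
have c0 : 0 < c by rewrite mulr_gt0// mulr_gt0 ?expR_gt0// divr_gt0.
rewrite -/c EFinM -lee_pdivlMl// -EFin_beta//.
apply: (leZ (fun z => z `^ n%:R)) => //.
- by rewrite invr_ge0 ltW.
- move=> y Iy; have /andP[af fM] := fb y Iy; have fy := f0 y Iy.
  rewrite powR_ge0/= powR_mulrn ?(ltW fy)// ler_pdivlMl// /w1.
  have /andP[h _] := pmf_le n (f y) (fb y Iy).
  have -> : c * f y ^+ n =
      a / b1 * (expR (- (L * M)) * (L ^+ n / n`!%:R * f y ^+ n)).
    by rewrite /c; ring.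
  apply: ler_pM => //.
  + by rewrite divr_ge0// ltW.
  + by rewrite mulr_ge0 ?expR_ge0// mulr_ge0 ?(ltW W0)// exprn_ge0// ltW.
  + by rewrite ler_pM2r// invr_gt0.
- by move=> y Iy; rewrite /w1 mulr_ge0 ?poisson_pmf_ge0// divr_ge0// ltW// f0.
Qed.

Context {d : measure_display} {Omega : measurableType d}.
Variables (P : probability Omega R) (Q : seq nat -> {RV P >-> R}).
Variable N : seq nat -> {RV P >-> nat}.
Hypothesis tree : is_limit_tree f lambda Q N.

Let NE v k : P (N v @^-1` [set k]) =
  (\int[cmu]_(y in I01) (type_density f v y * poisson_pmf (L * f y) k)%:E)%E.
Proof.
have := limit_tree_offspring tree v k measurableT.
by rewrite preimage_setT setTI setIT.
Qed.

Let root_pmfE k : P (N [::] @^-1` [set k]) = J0 k.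
Proof.
by rewrite NE; apply: eq_integral => y _; rewrite /type_density eqxx mul1r.
Qed.

Let child_pmfE j k : P (N [:: j] @^-1` [set k]) = J1 k.
Proof. by rewrite NE. Qed.

Let indep j m k : P (N [::] @^-1` [set m] `&` N [:: j] @^-1` [set k]) =
  (P (N [::] @^-1` [set m]) * P (N [:: j] @^-1` [set k]))%E.
Proof.
(* Independence is applied to the two labels [[::]] and [[:: j]], with unrestricted types. *)
have := @limit_tree_independent _ _ _ _ _ _ _ _ tree [:: [::]; [:: j]]
  (fun=> setT) (fun v => if v == [::] then m else k) isT (fun=> measurableT).
rewrite !big_cons big_nil mule1 !preimage_setT !setTI/= => <-.
congr (P _); apply/seteqP; split=> [w [h1 h2] v|w h].
  by rewrite /= !inE => /orP[] /eqP -> /=.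
split.
  by have := h [::]; rewrite /= !inE eqxx => /(_ isT)[].
by have := h [:: j]; rewrite /= !inE eqxx orbT => /(_ isT)[].
Qed.

(** Interface to the tail analysis: the types are integrated out, leaving two real mass functions,
    [q] for the root and [p] common to all its children. *)
Lemma limit_tree_offspring_law : exists q p : nat -> R,
  [/\ forall k, P (N [::] @^-1` [set k]) = (q k)%:E,
      forall j k, P (N [:: j] @^-1` [set k]) = (p k)%:E,
      forall j m k, P (N [::] @^-1` [set m] `&` N [:: j] @^-1` [set k]) =
        (q m * p k)%:E &
  [/\ forall k, q k.+1 <= L * M / k.+1%:R * q k,
      forall k, p k.+1 <= L * M / k.+1%:R * p k,
      0 < q 1%N &
      exists c K, [/\ 0 < c, 0 < K & forall n,
        c * (L ^+ n / n`!%:R * beta f n%:R) <= p n <=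
        K * (L ^+ n / n`!%:R * beta f n%:R)]]].
Proof.
have mN v k : measurable (N v @^-1` [set k]).
  by rewrite -[X in measurable X]setTI; exact: measurable_funP.
exists (fun k => fine (P (N [::] @^-1` [set k]))).
exists (fun k => fine (P (N [:: 0%N] @^-1` [set k]))).
have q_ k : (fine (P (N [::] @^-1` [set k])))%:E = J0 k.
  by rewrite fineK ?fin_num_measure// root_pmfE.
have p_ k : (fine (P (N [:: 0%N] @^-1` [set k])))%:E = J1 k.
  by rewrite fineK ?fin_num_measure// child_pmfE.
split; last split.
- by move=> k; rewrite q_ root_pmfE.
- by move=> j k; rewrite p_ child_pmfE.
- by move=> j m k; rewrite EFinM q_ p_ indep root_pmfE child_pmfE.
- by move=> k; rewrite -lee_fin EFinM !q_.
- by move=> k; rewrite -lee_fin EFinM !p_.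
- by rewrite -lte_fin q_.
- exists (a / b1 * expR (- (L * M))), (M / b1); split.
  + by rewrite mulr_gt0 ?expR_gt0// divr_gt0.
  + by rewrite divr_gt0.
  + move=> n; rewrite -!lee_fin p_; apply/andP; split.
      by apply: le_trans (beta_le_J1 n); rewrite lee_fin !mulrA.
    by apply: le_trans (J1_beta_le n) _; rewrite lee_fin !mulrA.
Qed.

End offspring.

(** * Union bound for the tail of the bias *)

Section bias_tail.
Context {R : realType} {d : measure_display} {Omega : measurableType d}.
Variables (P : probability Omega R) (N : seq nat -> {RV P >-> nat}).
Variables (q p : nat -> R) (Lam : R).
Hypothesis Lam0 : 0 <= Lam.
Hypothesis qE : forall k, P (N [::] @^-1` [set k]) = (q k)%:E.
Hypothesis pE : forall j k, P (N [:: j] @^-1` [set k]) = (p k)%:E.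
Hypothesis qpE : forall j m k,
  P (N [::] @^-1` [set m] `&` N [:: j] @^-1` [set k]) = (q m * p k)%:E.
Hypothesis qS : forall k, q k.+1 <= Lam / k.+1%:R * q k.
Hypothesis pS : forall k, p k.+1 <= Lam / k.+1%:R * p k.

Let root m : set Omega := N [::] @^-1` [set m].
Let tail j n : set Omega := [set w | (n <= N [:: j] w)%N].

Let mN v (A : set nat) : measurable (N v @^-1` A).
Proof. by rewrite -[X in measurable X]setTI; exact: measurable_funP. Qed.

Let mroot m : measurable (root m). Proof. exact: mN. Qed.
Let mtail j n : measurable (tail j n).
Proof. exact: (mN _ [set k | (n <= k)%N]). Qed.

Let q0 k : 0 <= q k.
Proof. by rewrite -lee_fin -qE measure_ge0. Qed.

Let p0 k : 0 <= p k.
Proof. by rewrite -lee_fin -(pE 0) measure_ge0. Qed.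

Let tailE j n : tail j n = \bigcup_k (N [:: j] @^-1` [set (k + n)%N]).
Proof.
apply/seteqP; split=> [w nw|w [k _ /= kn]]; last by rewrite /tail/= kn leq_addl.
by exists (N [:: j] w - n)%N => //=; rewrite subnK.
Qed.

Let fiber_triv v n : trivIset setT (fun k => N v @^-1` [set (k + n)%N]).
Proof.
by move=> i j _ _ [w [/= -> /eqP]]; rewrite eqn_add2r => /eqP.
Qed.

Let measure_bigcupT (F : nat -> set Omega) : (forall k, measurable (F k)) ->
  trivIset setT F -> P (\bigcup_k F k) = (\sum_(k <oo) P (F k))%E.
Proof.
move=> mF tF; rewrite measure_bigcup//.
by apply: eq_eseriesl => k; rewrite in_setT.
Qed.

Lemma tail_series j n : P (tail j n) = (\sum_(k <oo) (p (k + n))%:E)%E.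
Proof.
rewrite tailE measure_bigcupT//.
by apply: eq_eseriesr => k _; rewrite pE.
Qed.

(** Independence of the point masses is summed over the fibres of the tail; child 0 can stand for
    child [j] because their laws agree. *)
Lemma joint_tail j m n :
  P (root m `&` tail j n) = ((q m)%:E * P (tail 0 n))%E.
Proof.
rewrite tailE setI_bigcupr measure_bigcupT//; last 2 first.
- by move=> k; apply: measurableI => //; exact: mN.
- by apply: trivIset_setIl; exact: fiber_triv.
rewrite tail_series -nneseriesZl; last by move=> k _; rewrite lee_fin.
by apply: eq_eseriesr => k _; rewrite qpE EFinM.
Qed.

(** Termwise, the mass ratio at k + n is at most Lam / (k + n + 1), hence at most Lam / (n + 1). *)
Lemma tail_ratio n :
  (P (tail 0 n.+1) <= (Lam / n.+1%:R)%:E * P (tail 0 n))%E.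
Proof.
rewrite !tail_series -nneseriesZl; last by move=> k _; rewrite lee_fin.
apply: lee_nneseries => k *; first by rewrite lee_fin.
rewrite lee_fin addnS; apply: le_trans (pS _) _.
rewrite ler_wpM2r// ler_wpM2l// lef_pV2 ?posrE ?ltr0n// ler_nat.
by rewrite ltnS leq_addl.
Qed.

Lemma pmf_le_tail n : ((p n)%:E <= P (tail 0 n))%E.
Proof.
have mA := mN [:: 0] [set n].
rewrite -(pE 0); apply: le_measure; rewrite ?inE//.
by move=> w /= wn; rewrite /tail/= wn.
Qed.

Lemma tail_le_pmf n : (P (tail 0 n) <= (p n)%:E + P (tail 0 n.+1))%E.
Proof.
have mA := mN [:: 0] [set n]; have mB := mtail 0 n.+1.
rewrite -(pE 0); apply: le_trans (measureU2 P mA mB).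
apply: le_measure; rewrite ?inE//; first exact: measurableU.
by move=> w; rewrite /tail/= leq_eqVlt => /orP[/eqP ->|]; [left|right].
Qed.

Lemma root_mass : (\sum_(k <oo) (q k)%:E = 1)%E.
Proof.
rewrite -(@probability_setT _ _ _ P).
have -> : [set: Omega] = \bigcup_k root k.
  by apply/seteqP; split=> // w _; exists (N [::] w).
rewrite measure_bigcupT//.
  by apply: eq_eseriesr => k _; rewrite -qE.
by have := fiber_triv [::] 0; under eq_fun do rewrite addn0.
Qed.

(** On each event fixing the root degree, the bias is a finite sum with a constant number of
    terms. *)
Let mbias (x : R) : measurable [set w | x <= friendship_bias N w].
Proof.
have -> : [set w | x <= friendship_bias N w] = \bigcup_m (root m `&`
    [set w | x <= if m == 0%N then 0 else
      (\sum_(j < m) ((N [:: nat_of_ord j] w)%:R + 1)) / m%:R - m%:R]).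
  apply/seteqP; split=> [w xw|w [m _ [/= <-]]]; last by [].
  by exists (N [::] w).
apply: bigcupT_measurable => m; apply: measurableI => //.
case: eqP => [_|_].
  have [x0|x0] := leP x 0.
    by rewrite (_ : [set _ | _] = setT)//; apply/seteqP; split.
  by rewrite (_ : [set _ | _] = set0)//; apply/seteqP; split.
have mg j : measurable_fun setT (fun w => (N [:: j] w)%:R + 1 : R).
  apply: measurable_funD => //.
  by move=> _ B mB; rewrite setTI; exact: (mN [:: j] (GRing.natmul 1 @^-1` B)).
rewrite (_ : [set _ | _] = setT `&` (fun w : Omega =>
    (\sum_(j < m) ((N [:: nat_of_ord j] w)%:R + 1)) / m%:R - m%:R)
      @^-1` `[x, +oo[); last first.
  by rewrite setTI; apply/seteqP; split=> w /=; rewrite in_itv/= andbT.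
suff : measurable_fun setT (fun w : Omega =>
    (\sum_(j < m) ((N [:: nat_of_ord j] w)%:R + 1)) / m%:R - m%:R : R).
  by apply => //; exact: measurable_itv.
apply: measurable_funB => //; apply: measurable_funM => //.
exact: measurable_sum.
Qed.

(** [xn] says that [n] is the ceiling of [x], so real thresholds for degrees become integer ones. *)
Variables (x : R) (n : nat).
Hypotheses (x0 : 0 < x) (xn : forall k : nat, (x <= k%:R) = (n <= k)%N).

Let x1n k : (x + 1 <= k%:R) = (n < k)%N.
Proof.
case: k => [|k]; first by rewrite ltn0 leNgt addr_gt0.
by rewrite -natr1 lerD2r xn.
Qed.

Lemma bias_event_lower :
  root 1 `&` tail 0 n `<=` [set w | x <= friendship_bias N w].
Proof.
move=> w [/= rw]; rewrite /tail/= -xn => xw.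
rewrite /friendship_bias /deg_root rw/= big_ord1/= divr1 addrK.
exact: xw.
Qed.

(* If the m children have mean degree at least x + m - 1 with m >= 2, then one
   of them has degree at least x + 1. *)
Lemma bias_event_upper :
  [set w | x <= friendship_bias N w] `<=`
  (root 1 `&` tail 0 n) `|`
  \bigcup_m \big[setU/set0]_(j < m.+1) (root m.+1 `&` tail j n.+1).
Proof.
move=> w /=; rewrite /friendship_bias /deg_root.
case E : (N [::] w) => [|[|m]] /=.
- by rewrite leNgt x0.
- rewrite big_ord1 divr1 addrK xn => nw; left; split => //.
move=> xw; right; exists m.+1 => //; 
rewrite -(bigcup_mkord _ (fun j => root m.+2 `&` tail j n.+1)).
have [/existsP[j jP]|] := boolP [exists j : 'I_m.+2, n < N [:: val j] w]%N.
  by exists (val j) => /=.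
rewrite negb_exists => /forallP jP; exfalso.
have : (\sum_(j < m.+2) ((N [:: val j] w)%:R + 1)) < m.+2%:R * (x + 2).
  apply: (@lt_le_trans _ _ (\sum_(j < m.+2) (x + 2))); last first.
    by rewrite sumr_const card_ord mulr_natl.
  apply: ltr_sum; first by apply/hasP; exists ord0; rewrite ?mem_index_enum.
  move=> j _; have := jP j; rewrite -x1n -ltNge; lra.
move: xw; rewrite lerBrDr ler_pdivlMr ?ltr0n//= mulrC => h1 h2.
have := le_lt_trans h1 h2; rewrite ltr_pM2l ?ltr0n// ltrD2l.
by rewrite ltr_nat.
Qed.

(** For the upper bound, roots with m + 1 children contribute at most (m + 1) q(m + 1) times the
    tail at n + 1. The ratio estimate bounds (m + 1) q(m + 1) by Lam q(m), and the masses q(m) sum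
    to 1. *)
Lemma bias_tail_bounds :
  ((q 1)%:E * P (tail 0 n) <= P [set w | (x <= friendship_bias N w)%R]
   <= (q 1)%:E * P (tail 0 n) + Lam%:E * P (tail 0 n.+1))%E.
Proof.
rewrite -(joint_tail 0 1); apply/andP; split.
  by apply: le_measure; rewrite ?inE//; [exact: measurableI|
    exact: bias_event_lower].
set U := \bigcup_m \big[setU/set0]_(j < m.+1) (root m.+1 `&` tail j n.+1).
have mV m : measurable (\big[setU/set0]_(j < m.+1) (root m.+1 `&` tail j n.+1)).
  by apply: bigsetU_measurable => j _; exact: measurableI.
have mU : measurable U by apply: bigcupT_measurable.
apply: (@le_trans _ _ (P ((root 1 `&` tail 0 n) `|` U))).
  apply: le_measure; rewrite ?inE//; last exact: bias_event_upper.
  by apply: measurableU => //; exact: measurableI.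
apply: le_trans (measureU2 _ _ _) _ => //; first exact: measurableI.
apply: leeD => //.
apply: (@le_trans _ _
    (\sum_(m <oo) (Lam%:E * P (tail 0 n.+1)) * (q m)%:E)%E); last first.
  have Pfin : P (tail 0 n.+1) \is a fin_num by exact: fin_num_measure.
  rewrite -(fineK Pfin) -EFinM nneseriesZl; last first.
    by move=> k _; rewrite lee_fin.
  by rewrite root_mass mule1.
apply: le_trans (measure_sigma_subadditive P mV mU (@subset_refl _ U)) _.
apply: lee_nneseries => // m _.
have mG j : (j < m.+1)%N -> measurable (root m.+1 `&` tail j n.+1).
  by move=> _; exact: measurableI.
apply: le_trans (Boole_inequality P
  (A := fun j => root m.+1 `&` tail j n.+1) mG) _.
rewrite (eq_bigr (fun=> (q m.+1)%:E * P (tail 0 n.+1))%E); last first.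
  by move=> j _; exact: joint_tail.
have Pfin : P (tail 0 n.+1) \is a fin_num by exact: fin_num_measure.
rewrite -(fineK Pfin) -!EFinM sumEFin lee_fin sumr_const card_ord.
have t0 : 0 <= fine (P (tail 0 n.+1)) by rewrite fine_ge0.
move: (fine _) t0 => t t0; rewrite -mulrnAl mulrAC ler_wpM2r//.
have := qS m; rewrite mulrAC ler_pdivlMr ?ltr0n// => qm.
by rewrite -mulr_natr.
Qed.

End bias_tail.

Lemma nat_ceil (R : realType) (x : R) :
  exists n : nat, forall k : nat, (x <= k%:R) = (n <= k)%N.
Proof.
have ex : exists k : nat, x <= k%:R.
  by exists (Num.truncn x).+1; rewrite ltW// truncnS_gt.
case: (ex_minnP ex) => n xn nmin; exists n => k.
by apply/idP/idP => [/nmin//|nk]; rewrite (le_trans xn)// ler_nat.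
Qed.

(** * Asymptotics of the tail of the bias *)

Section conclusion.
Context {R : realType} {d : measure_display} {Omega : measurableType d}.
Variables (f : R -> R) (lambda : R).
Hypotheses (Ff : class_F f) (lambda0 : 0 < lambda).
Variables (P : probability Omega R) (Q : seq nat -> {RV P >-> R}).
Variable N : seq nat -> {RV P >-> nat}.
Hypothesis tree : is_limit_tree f lambda Q N.

Let L := lambda * beta f 1.
Let Lam := L * M_plus f.
Let L0 : 0 < L. Proof. by rewrite mulr_gt0// beta_gt0. Qed.
Let Lam0 : 0 < Lam. Proof. by rewrite mulr_gt0// M_plus_gt0. Qed.

Let t n : R := Pr P [set w | (n <= N [:: 0%N] w)%N].
Let B (x : R) : R := Pr P [set w | x <= friendship_bias N w].

Let law : exists q1, exists p : nat -> R,
  [/\ 0 < q1 /\ Pr P [set w | deg_root N w = 1%N] = q1,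
      forall n, t n.+1 <= Lam / n.+1%:R * t n,
      forall n, p n <= t n <= p n + t n.+1,
      forall x n, 0 < x -> (forall k : nat, (x <= k%:R) = (n <= k)%N) ->
        q1 * t n <= B x <= q1 * t n + Lam * t n.+1 &
      exists c K, [/\ 0 < c, 0 < K & forall n,
        c * (L ^+ n / n`!%:R * beta f n%:R) <= p n <=
        K * (L ^+ n / n`!%:R * beta f n%:R)]].
Proof.
have [q [p [qE pE qpE [qS pS q1 pb]]]] :=
  limit_tree_offspring_law f lambda Ff lambda0 P Q N tree.
have tE n : P [set w | (n <= N [:: 0%N] w)%N] = (t n)%:E.
  have mt : measurable [set w | (n <= N [:: 0%N] w)%N].
    rewrite -[X in measurable X]setTI.
    exact: (measurable_funP (N [:: 0%N]) measurableT [set k | (n <= k)%N]).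
  by rewrite /t /Pr fineK// fin_num_measure.
exists (q 1%N), p; split => //.
- by split => //; rewrite /Pr -[[set w | _]]/(N [::] @^-1` [set 1%N]) qE.
- move=> n; rewrite -lee_fin EFinM -!tE.
  exact: (tail_ratio P N p Lam (ltW Lam0) pE pS).
- move=> n; rewrite -!lee_fin EFinD -!tE; apply/andP; split.
    exact: (pmf_le_tail P N p pE).
  exact: (tail_le_pmf P N p pE).
- move=> x n x0 xn.
  have := bias_tail_bounds P N q p Lam qE pE qpE qS x n x0 xn.
  rewrite !tE -!EFinM -EFinD => /andP[h1 h2].
  have Bfin : P [set w | x <= friendship_bias N w] \is a fin_num.
    rewrite ge0_fin_numE ?measure_ge0//; apply: le_lt_trans h2 _.
    by rewrite ltry.
  by rewrite /B /Pr -!lee_fin fineK// h1.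
Qed.

(** With n the ceiling of x, the relative error is at most Lam t(n + 1) / (q1 t(n)), hence at most
    Lam^2 / (q1 (n + 1)), which vanishes as x grows. *)
Lemma friendship_bias_equiv : asymp_equiv (pinfty_nbhs R)
  (fun x : R => Pr P [set w | x <= friendship_bias N w])
  (fun x : R => Pr P [set w | deg_root N w = 1%N] *
                Pr P [set w | x <= (deg_child N 0 w)%:R]).
Proof.
have [q1 [p [[q10 q1E] tS pt Bt [c [K [c0 K0 pb]]]]]] := law.
have p_gt0 n : 0 < p n.
  have /andP[+ _] := pb n; apply: lt_le_trans.
  by rewrite !mulr_gt0 ?exprn_gt0 ?invr_gt0 ?ltr0n ?fact_gt0// beta_gt0.
have t_gt0 n : 0 < t n.
  by have /andP[+ _] := pt n; apply: lt_le_trans.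
rewrite /asymp_equiv q1E; apply/cvgrPdist_le => e e0; near=> x.
have x0 : 0 < x by near: x; exact: nbhs_pinfty_gt.
have [n xn] := nat_ceil R x.
have -> : Pr P [set w | x <= (deg_child N 0 w)%:R] = t n.
  by rewrite /t; congr (Pr P _); apply/seteqP; split=> w /=; rewrite xn.
have /andP[h1 h2] := Bt x n x0 xn.
rewrite -/(B x).
have qt0 : 0 < q1 * t n by rewrite mulr_gt0.
have -> : 1 - B x / (q1 * t n) = - ((B x - q1 * t n) / (q1 * t n)).
  by rewrite mulrBl divff ?gt_eqF// opprB.
rewrite normrN ger0_norm; last by rewrite divr_ge0 ?subr_ge0// ltW.
rewrite ler_pdivrMr// lerBlDl (le_trans h2)// lerD2l.
have xe : Lam * Lam / (q1 * e) <= x.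
  by near: x; apply: nbhs_pinfty_ge; exact: num_real.
have xn1 : x <= n.+1%:R by rewrite xn leqnSn.
apply: (@le_trans _ _ (Lam * (Lam / n.+1%:R * t n))).
  by rewrite ler_pM2l.
have qe0 : 0 < q1 * e by rewrite mulr_gt0.
have -> : Lam * (Lam / n.+1%:R * t n) = Lam * Lam / n.+1%:R * t n by ring.
have -> : e * (q1 * t n) = q1 * e * t n by ring.
rewrite ler_pM2r// ler_pdivrMr//.
move: xe; rewrite ler_pdivrMr// => /le_trans; apply.
by rewrite mulrC ler_pM2l.
Unshelve. all: by end_near. Qed.

(** Splits off L^n, leaving the factor (e/n)^n of Stirling's formula. *)
Let rate_expE n : (0 < n)%N ->
  expR (- n%:R * ln (n%:R / (lambda * beta f 1 * expR 1))) =
  L ^+ n * expR (- n%:R * ln (n%:R / expR 1)) :> R.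
Proof.
move=> n0; have n0R : 0 < n%:R :> R by rewrite ltr0n.
have b10 : 0 < beta f 1 by exact: beta_gt0.
rewrite -/L !ln_div ?posrE ?mulr_gt0 ?expR_gt0//.
rewrite lnM ?posrE ?expR_gt0// expRK.
rewrite -[in RHS](@lnK _ L) ?posrE// -expRM_natl -expRD.
by congr expR; ring.
Qed.

(** The tail of the bias is compared with t(n), then with p(n), then with L^n beta_n / n!. The order
    is taken along integers: the tail of a child degree is constant on each interval []n, n + 1]],
    while the comparison function drops by a factor of order n across it. *)
Lemma friendship_bias_order : asymp_order \oo
  (fun x : nat => Pr P [set w | (x%:R : R) <= friendship_bias N w])
  (fun x : nat => (Num.sqrt x%:R)^-1 * beta f x%:R *
     expR (- x%:R * ln (x%:R / (lambda * beta f 1 * expR 1)))).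
Proof.
have [q1 [p [[q10 q1E] tS pt Bt [c [K [c0 K0 pb]]]]]] := law.
pose e1 : R := expR (- 1).
have e10 : 0 < e1 by exact: expR_gt0.
apply: (@bounds_asymp_order _ _ _ _ _ (q1 * c * e1) ((q1 * 2 + Lam) * K)).
  by rewrite !mulr_gt0.
near=> n.
have n0 : (0 < n)%N by near: n; exact: nbhs_infty_gt.
have n0R : 0 < n%:R :> R by rewrite ltr0n.
(* Past this threshold t(n + 1) <= t(n) / 2, so t(n) <= p(n) + t(n + 1) gives t(n) <= 2 p(n) and t(n
   + 1) <= p(n). *)
have nLam : 2 * Lam <= n%:R.
  near: n; exact: nbhs_infty_ger.
rewrite rate_expE//.
have [S1 S2] := @fact_stirling R n n0.
set S := _ * expR _ in S1 S2.
have -> : (Num.sqrt n%:R)^-1 * beta f n%:R *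
    (L ^+ n * expR (- n%:R * ln (n%:R / expR 1))) = L ^+ n * S * beta f n%:R.
  by rewrite /S; ring.
have S0 : 0 < S by rewrite mulr_gt0 ?expR_gt0// invr_gt0 sqrtr_gt0.
have Ln0 : 0 < L ^+ n by rewrite exprn_gt0.
have bn0 : 0 < beta f n%:R by rewrite beta_gt0.
split; first by rewrite mulr_gt0// mulr_gt0.
have /andP[b1 b2] := Bt n%:R n n0R (fun k => ler_nat R n k).
have /andP[pt1 pt2] := pt n.
have /andP[pb1 pb2] := pb n.
rewrite -/(B n%:R); apply/andP; split.
  have -> : q1 * c * e1 * (L ^+ n * S * beta f n%:R) =
      q1 * (c * (L ^+ n * (e1 * S) * beta f n%:R)) by ring.
  apply: le_trans b1; rewrite ler_pM2l//.
  apply: le_trans pt1; apply: le_trans pb1.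
  by rewrite ler_pM2l// ler_pM2r// ler_pM2l.
have t0 : 0 <= t n by rewrite /t /Pr fine_ge0// measure_ge0.
have tn1 : t n.+1 <= 2^-1 * t n.
  apply: le_trans (tS n) _; rewrite ler_wpM2r// ler_pdivrMr//.
  rewrite -ler_pdivrMl ?invr_gt0// invrK; apply: le_trans nLam _.
  by rewrite ler_nat.
have {tn1 pt2}[tp t1p] : t n <= 2 * p n /\ t n.+1 <= p n.
  by move: (t n) (t n.+1) tn1 pt2 => u v h1 h2; split; lra.
have Bp : B n%:R <= (q1 * 2 + Lam) * p n.
  apply: (le_trans b2); rewrite mulrDl lerD//.
    by rewrite -mulrA ler_pM2l.
  by rewrite ler_pM2l.
have qL0 : 0 < q1 * 2 + Lam by rewrite addr_gt0// mulr_gt0.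
apply: (le_trans Bp); rewrite -[leRHS]mulrA ler_pM2l//.
by apply: (le_trans pb2); rewrite ler_pM2l// ler_pM2r// ler_pM2l.
Unshelve. all: by end_near. Qed.

End conclusion.

Theorem theorem4p6 (R : realType) (f : R -> R) (lambda : R) :
  class_F f -> 0 < lambda ->
  [/\ (forall (d : measure_display) (Omega : measurableType d)
         (P : probability Omega R)
         (Q : seq nat -> {RV P >-> R}) (N : seq nat -> {RV P >-> nat}),
         is_limit_tree f lambda Q N ->
         asymp_equiv (pinfty_nbhs R)
           (fun x : R => Pr P [set w | x <= friendship_bias N w])
           (fun x : R => Pr P [set w | deg_root N w = 1%N] *
                         Pr P [set w | x <= (deg_child N 0 w)%:R])
         /\
         asymp_order \oo
           (fun x : nat => Pr P [set w | (x%:R : R) <= friendship_bias N w])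
           (fun x : nat => (Num.sqrt x%:R)^-1 * beta f x%:R *
              expR (- x%:R * ln (x%:R / (lambda * beta f 1 * expR 1))))),
      (0 < completed_lebesgue_measure
             [set y : R | y \in `[0%R, 1%R] /\ f y = M_plus f])%E ->
      asymp_order (pinfty_nbhs R) (beta f) (fun x : R => M_plus f `^ x) &
      forall ystar alpha : R,
        ystar \in `[0, 1] -> 0 < alpha ->
        f ystar = M_plus f ->
        asymp_order (within `[0, 1] ystar^')
          (fun y : R => f ystar - f y)
          (fun y : R => `|y - ystar| `^ alpha) ->
        (forall U : set R, nbhs ystar U ->
           exists2 e : R, 0 < e &
             forall y : R, y \in `[0, 1] -> ~ U y -> f y <= M_plus f - e) ->
        asymp_order (pinfty_nbhs R) (beta f)
          (fun x : R => x `^ (- alpha^-1) * M_plus f `^ x)].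
Proof.
move=> Ff lambda0; split.
- move=> d Omega P Q N tree; split.
    exact: (friendship_bias_equiv f lambda Ff lambda0 P Q N tree).
  exact: (friendship_bias_order f lambda Ff lambda0 P Q N tree).
- exact: beta_order_flat_max.
- exact: beta_order_peak.
Qed.
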